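(* Let $T$ be a forest and let $r\leq t$ be positive integers. Then the class $\mathscr C$ of all $(T,K_{r,t})$-free graphs is $\chi_s$-bounded if and only if $r=1$ or $T$ is a subgraph of the $1$-subdivision of a tree.
   Context: All graphs are finite, simple and undirected. A graph is $F$-free if it does not contain $F$ as an induced subgraph; it is $(F_1,F_2)$-free if it is both $F_1$-free and $F_2$-free. The star chromatic number $\chi_s(G)$ is the minimum number of colors in a proper coloring of $G$ such that the union of any two color classes induces a star forest. $\omega(G)$ is the clique number of $G$. A hereditary class $\mathscr C$ (i.e. closed under induced subgraphs) is $\chi_s$-bounded if there is a function $f$ such that $\chi_s(G)\leq f(\omega(G))$ for every $G\in\mathscr C$. The $1$-subdivision of a graph is obtained by subdividing each edge by exactly one new vertex. $K_{r,t}$ is the complete bipartite graph with parts of sizes $r$ and $t$. *)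

(* Defs.v *)
From mathcomp Require Import all_boot.

Set Implicit Arguments.
Unset Strict Implicit.
Unset Printing Implicit Defensive.

Record sgraph := SGraph {
  vertex :> finType;
  adj : rel vertex;
  adj_sym : symmetric adj;
  adj_irrefl : irreflexive adj
}.

Definition is_induced_subgraph (F G : sgraph) : Prop :=
  exists f : F -> G, injective f /\ forall x y, adj (f x) (f y) = adj x y.

(* Not necessarily induced. *)
Definition is_subgraph (H G : sgraph) : Prop :=
  exists f : H -> G, injective f /\ forall x y, adj x y -> adj (f x) (f y).

Definition free (F G : sgraph) : Prop := ~ is_induced_subgraph F G.

(* A duplicate-free cyclic sequence of length 2 is just an edge; genuine cycles
   have length at least 3. *)
Definition forest (G : sgraph) : Prop :=
  forall c : seq G, ucycle (@adj G) c -> size c < 3.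

Definition connected (G : sgraph) : Prop :=
  0 < #|G| /\ forall x y : G, connect (@adj G) x y.

Definition tree (G : sgraph) : Prop := forest G /\ connected G.

Section Induced.
Variables (G : sgraph) (A : {set G}).

Definition induced_adj : rel {x : G | x \in A} :=
  fun x y => adj (val x) (val y).

Lemma induced_adj_sym : symmetric induced_adj.
Proof. by move=> x y; apply: adj_sym. Qed.

Lemma induced_adj_irrefl : irreflexive induced_adj.
Proof. by move=> x; apply: adj_irrefl. Qed.

Definition induced : sgraph := SGraph induced_adj_sym induced_adj_irrefl.

End Induced.

Section CompleteBipartite.
Variables r t : nat.

Definition Kbip_adj : rel ('I_r + 'I_t) := fun u v =>
  match u, v with
  | inl _, inr _ | inr _, inl _ => true
  | _, _ => false
  end.

Lemma Kbip_adj_sym : symmetric Kbip_adj.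
Proof. by case=> ? []. Qed.

Lemma Kbip_adj_irrefl : irreflexive Kbip_adj.
Proof. by case. Qed.

Definition Kbip : sgraph := SGraph Kbip_adj_sym Kbip_adj_irrefl.

End CompleteBipartite.

Definition edges (G : sgraph) : {set {set G}} :=
  [set e | [exists x, exists y, adj x y && (e == [set x; y])]].

(* The vertices [inr e] are the subdivision vertices. *)
Section Subdivision.
Variable G : sgraph.

Definition subdiv_adj : rel (G + {e : {set G} | e \in edges G}) := fun u v =>
  match u, v with
  | inl x, inr e | inr e, inl x => x \in val e
  | _, _ => false
  end.

Lemma subdiv_adj_sym : symmetric subdiv_adj.
Proof. by case=> ? []. Qed.

Lemma subdiv_adj_irrefl : irreflexive subdiv_adj.
Proof. by case. Qed.

Definition subdivision : sgraph := SGraph subdiv_adj_sym subdiv_adj_irrefl.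

End Subdivision.

Definition clique (G : sgraph) (A : {set G}) : bool :=
  [forall x in A, forall y in A, (x != y) ==> adj x y].

Definition omega (G : sgraph) : nat := \max_(A : {set G} | clique A) #|A|.

Definition component (G : sgraph) (x : G) : {set G} :=
  [set y | connect (@adj G) x y].

(* [K_{1,s}] with [s >= 0] leaves: [c] is the centre, and a single vertex is
   allowed. *)
Definition star (G : sgraph) : bool :=
  [exists c : G, forall x : G, forall y : G,
     adj x y == (x != y) && ((x == c) || (y == c))].

Definition star_forest (G : sgraph) : bool :=
  [forall x : G, star (induced (component x))].

Definition proper_coloring (G : sgraph) (k : nat) (c : {ffun G -> 'I_k}) : bool :=
  [forall x, forall y, adj x y ==> (c x != c y)].

Definition star_coloring (G : sgraph) (k : nat) (c : {ffun G -> 'I_k}) : bool :=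
  proper_coloring c &&
  [forall i, forall j, (i != j) ==>
     star_forest (induced [set x | (c x == i) || (c x == j)])].

Definition star_colorable (G : sgraph) (k : nat) : bool :=
  [exists c : {ffun G -> 'I_k}, star_coloring c].

Lemma small_star (G : sgraph) (x0 : G) :
  #|G| <= 2 -> (forall x y : G, connect (@adj G) x y) -> star G.
Proof.
move=> G2 conn; apply/existsP; exists x0; apply/forallP=> x; apply/forallP=> y.
have H3 (a b c : G) : a != b -> b != c -> c != a -> false.
  move=> ab bc ca; suff: 2 < #|G| by rewrite ltnNge G2.
  have := max_card (mem [:: a; b; c]); rewrite (card_uniqP _) //=.
  by rewrite !inE !negb_or ab bc eq_sym ca.
have [->|xy] := eqVneq x y; first by rewrite adj_irrefl.
have -> : (x == x0) || (y == x0).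
  case: eqVneq => //= xx0; case: eqVneq => //= yx0.
  by apply: (H3 x y x0); rewrite // eq_sym.
apply/eqP; have /connectP[p] := conn x y; case: p => [|z p] /=.
  by move=> _ yx; rewrite yx eqxx in xy.
case/andP=> xz _ _; have [<- //|zy] := eqVneq z y.
have zx : x != z by apply: contraTneq xz => ->; rewrite adj_irrefl.
by have := H3 x z y zx zy; rewrite eq_sym xy => /(_ isT).
Qed.

Lemma connect_component (G : sgraph) (x : G) (u v : induced (component x)) :
  connect (@adj (induced (component x))) u v.
Proof.
have csym := sym_connect_sym (@adj_sym G).
case: u v => [a xa] [b xb].
have /connectP[p] : connect (@adj G) a b.
  by move: xa xb; rewrite !inE csym => xa xb; apply: connect_trans xa xb.
elim: p a xa => [|z p IHp] a xa /=.
  by move=> _ ba; subst b; rewrite (bool_irrelevance xa xb) connect0.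
case/andP=> az pz zb.
have xz : z \in component x.
  by move: xa; rewrite !inE => xa; apply: connect_trans xa (connect1 az).
by apply: connect_trans (connect1 _) (IHp z xz pz zb).
Qed.

Lemma star_colorable_card (G : sgraph) : exists k, star_colorable G k.
Proof.
exists #|G|; apply/existsP; exists [ffun x => enum_rank x]; apply/andP; split.
  apply/forallP=> x; apply/forallP=> y; apply/implyP=> xy; rewrite !ffunE.
  by apply: contraTneq xy => /enum_rank_inj->; rewrite adj_irrefl.
apply/forallP=> i; apply/forallP=> j; apply/implyP=> _; apply/forallP=> x.
apply: small_star; last exact: connect_component.
  by exists x; rewrite inE connect0.
rewrite card_sig (leq_trans (max_card _)) // card_sig.
apply: (@leq_trans #|[set enum_val i; enum_val j]|); last by rewrite cards2; case: eqP.
apply: subset_leq_card; apply/subsetP=> y; rewrite !inE !ffunE.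
by case/orP=> /eqP<-; rewrite enum_rankK eqxx ?orbT.
Qed.

Definition chi_s (G : sgraph) : nat := ex_minn (star_colorable_card G).

Definition chi_s_bounded (C : sgraph -> Prop) : Prop :=
  exists f : nat -> nat, forall G : sgraph, C G -> chi_s G <= f (omega G).

Definition hereditary (C : sgraph -> Prop) : Prop :=
  forall H G : sgraph, is_induced_subgraph H G -> C G -> C H.

Definition free2 (F1 F2 G : sgraph) : Prop := free F1 G /\ free F2 G.

Lemma free2_hereditary (F1 F2 : sgraph) : hereditary (free2 F1 F2).
Proof.
move=> H G [f [injf Hf]] [F1G F2G].
by split=> -[g [injg Hg]]; [apply: F1G | apply: F2G];
  exists (f \o g); split=> [|x y]; [apply: inj_comp | rewrite /= Hf Hg
   | apply: inj_comp | rewrite /= Hf Hg].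
Qed.

(* Main.v *)
From Stdlib Require Classical_Prop.
From mathcomp Require Import all_boot all_order all_algebra.
From mathcomp Require Import zify ring lra.
Require Import Defs.

Set Implicit Arguments.
Unset Strict Implicit.
Unset Printing Implicit Defensive.

(** Necessity: for [r >= 2] the 1-subdivisions of complete graphs are [K_{r,t}]-free with
    clique number at most 2, and a pigeonhole argument at one branch vertex shows that their
    star chromatic number is unbounded. So one of them contains [T], which makes the forest
    [T] bipartite with all degrees on one side at most 2; adding leaves one at a time, such a
    forest embeds into the 1-subdivision of a tree.

    Sufficiency: for [r = 1], Ramsey's theorem bounds the degree, and the square of the graph
    can be coloured greedily. Otherwise [T] is an induced subgraph of the 1-subdivision [T'] of
    a tree, and Ramsey's theorem excludes a large biclique subgraph. If the degeneracy is large,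
    some induced subgraph has large minimum degree; map [T'] into it by a random walk
    indexed by [T'], started from the stationary distribution. Without large bicliques each
    vertex [v] has boundedly many vertices [u] adjacent to a positive fraction of its
    neighbours, and by reversibility the images of two vertices form such a pair with
    probability [O(1 / D)], so that some image is an induced copy of [T'].
    Hence the graph has an acyclic orientation of bounded out-degree. Giving distinct colours
    to the ends of each edge, of each directed path of length 2, and to any two
    out-neighbours of a vertex produces a star colouring. If this needs too many colours, then
    many pairs of vertices have a common in-neighbour; sampling the vertices at random leaves
    an induced 1-subdivision of a dense graph, in which [T'] is found greedily. *)

(** * Degenerate relations and star colourings *)

(** For symmetric [e] this is ([d] - 1)-degeneracy. It is stated for relations because it serves the
    graph, its square, [augmented] and [clean_cherry]. *)
Definition degenerate (V : finType) (e : rel V) (d : nat) : bool :=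
  [forall X : {set V}, (X != set0) ==> [exists x in X, #|[set y in X | e x y]| < d]].

Lemma degenerateP (V : finType) (e : rel V) (d : nat) (X : {set V}) :
  degenerate e d -> X != set0 -> exists2 x, x \in X & #|[set y in X | e x y]| < d.
Proof. by move=> /forallP/(_ X)/implyP h /h /exists_inP. Qed.

Lemma degeneratePn (V : finType) (e : rel V) (d : nat) :
  ~~ degenerate e d ->
  exists2 X : {set V}, X != set0 & forall x, x \in X -> d <= #|[set y in X | e x y]|.
Proof.
case/forallPn=> X; rewrite negb_imply => /andP[X0 /exists_inPn h].
by exists X => // x /h; rewrite -leqNgt.
Qed.

Lemma degenerate_ind (V : finType) (e : rel V) (d : nat) (P : {set V} -> Prop) :
  degenerate e d -> P set0 ->
  (forall (X : {set V}) x, x \in X -> #|[set y in X | e x y]| < d -> P (X :\ x) -> P X) ->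
  forall X, P X.
Proof.
move=> de P0 PS X; have [n] := ubnP #|X|.
elim: n X => // n IH X Xn; have [->//|X0] := eqVneq X set0.
have [x xX xd] := degenerateP de X0; apply: (PS X x) => //; apply: IH.
by move: Xn; rewrite (cardsD1 x X) xX.
Qed.

(** A low-degree vertex is removed and ranked above all that remain. Pointing edges towards smaller
    [rho] gives an acyclic orientation. *)
Lemma degenerate_rank (V : finType) (e : rel V) (d : nat) :
  degenerate e d ->
  exists2 rho : V -> nat, injective rho &
    forall x, #|[set y | e x y & rho y < rho x]| < d.
Proof.
move=> de; suff [rho injr h] : exists2 rho : V -> nat, {in setT &, injective rho} &
    forall x, x \in setT -> #|[set y in setT | e x y & rho y < rho x]| < d.
  exists rho => [x y|x]; first by apply: injr; rewrite inE.
  apply: leq_ltn_trans (h x (in_setT x)); apply: subset_leq_card.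
  by apply/subsetP=> y; rewrite !inE.
move: [set: V]; apply: (degenerate_ind de) => [|X x xX xd [rho injr h]].
  by exists (fun=> 0) => x; rewrite inE.
pose m := (\max_(y in X) rho y).+1.
have mP y : y \in X -> rho y < m by move=> yX; rewrite ltnS; apply: leq_bigmax_cond.
exists (fun y => if y == x then m else rho y) => [y z yX zX|y yX] /=.
  case: (eqVneq y x) => [->|yx]; case: (eqVneq z x) => [->|zx] // E.
  - by have := mP z zX; rewrite -E ltnn.
  - by have := mP y yX; rewrite E ltnn.
  - by apply: injr; rewrite // !inE ?yx ?zx.
have [yx|yx] := eqVneq y x.
  subst y; apply: leq_ltn_trans xd; apply: subset_leq_card; apply/subsetP=> z.
  by rewrite !inE; case/and3P=> -> ->.
apply: leq_ltn_trans (h y _); last by rewrite !inE yx.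
apply: subset_leq_card; apply/subsetP=> z; rewrite !inE.
case: eqVneq => [->|zx] /and3P[zX -> //=]; last by rewrite zX.
by rewrite ltnNge ltnW ?mP.
Qed.

(** Greedy colouring in the reverse of the removal order; the extra colour makes [ord0] available in
    the base case. *)
Lemma degenerate_coloring (V : finType) (e : rel V) (d : nat) :
  symmetric e -> irreflexive e -> degenerate e d ->
  exists c : V -> 'I_d.+1, forall x y, e x y -> c x != c y.
Proof.
move=> esym eirr de; suff [c h] : exists c : V -> 'I_d.+1,
    forall x y, x \in setT -> y \in setT -> e x y -> c x != c y.
  by exists c => x y; apply: h; rewrite inE.
move: [set: V]; apply: (degenerate_ind de) => [|X x xX xd [c h]].
  by exists (fun=> ord0) => x y; rewrite inE.
have [i iN] : exists i, i \notin c @: [set y in X | e x y].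
  apply/existsP; rewrite -negb_forall; apply/negP=> /forallP h'.
  have : #|'I_d.+1| <= #|c @: [set y in X | e x y]|.
    by apply: subset_leq_card; apply/subsetP=> i _; apply: h'.
  rewrite card_ord => /leq_trans/(_ (leq_imset_card _ _)).
  by rewrite leqNgt ltnS (ltnW xd).
have iN' y : y \in X -> e x y -> i != c y.
  move=> yX xy; apply: contraNneq iN => ->; apply: imset_f.
  by rewrite inE yX.
exists (fun y => if y == x then i else c y) => y z yX zX yz.
case: (eqVneq y x) => [yx|yx]; case: (eqVneq z x) => [zx|zx].
- by rewrite yx zx eirr in yz.
- by apply: iN'; rewrite // -yx.
- by rewrite eq_sym; apply: iN'; rewrite // -zx esym.
- by apply: h; rewrite // !inE ?yx ?zx.
Qed.

(** Each removed vertex takes fewer than [d] edges with it, and every edge is counted from both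
    ends. *)
Lemma degenerate_card_pairs (V : finType) (e : rel V) (d : nat) (X : {set V}) :
  symmetric e -> irreflexive e -> degenerate e d ->
  \sum_(x in X) #|[set y in X | e x y]| <= 2 * d * #|X|.
Proof.
move=> esym eirr de; move: X; apply: (degenerate_ind de) => [|X x xX xd IH].
  by rewrite big_set0.
rewrite (cardsD1 x X) xX mulnDr muln1 (big_setD1 x) //=.
have -> : 2 * d = d + d by rewrite mul2n addnn.
rewrite -addnA leq_add //; first exact: ltnW.
apply: (@leq_trans (\sum_(y in X :\ x) (#|[set z in X :\ x | e y z]| + e x y))).
  apply: leq_sum => y; rewrite !inE => /andP[yx yX].
  rewrite (cardsD1 x) addnC !inE xX esym /= leq_add2r.
  by apply: subset_leq_card; apply/subsetP=> z; rewrite !inE andbA.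
rewrite big_split addnC leq_add //=; first by rewrite addnn -mul2n.
apply: leq_trans (ltnW xd); rewrite (eq_bigr (fun y => if e x y then 1 else 0)); last first.
  by move=> y _; case: (e x y).
rewrite -big_mkcondr sum1dep_card; apply: subset_leq_card; apply/subsetP=> z.
by rewrite !inE => /andP[/andP[_ ->] ->].
Qed.

(** The second hypothesis forbids bicoloured paths on four vertices; [a] and [y] differ because
    their colours do. Two-coloured components are then stars. *)
Lemma star_coloringI (G : sgraph) (k : nat) (c : G -> 'I_k) :
  (forall x y, adj x y -> c x != c y) ->
  (forall a b x y : G, adj a b -> adj b x -> adj x y -> a != x -> b != y ->
     c a = c x -> c b = c y -> False) ->
  star_colorable G k.
Proof.
move=> pc noP4; apply/existsP; exists [ffun x => c x]; apply/andP; split.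
  by apply/forallP=> x; apply/forallP=> y; apply/implyP; rewrite !ffunE; apply: pc.
apply/forallP=> i; apply/forallP=> j; apply/implyP=> ij; apply/forallP=> x0.
set S := [set x | _] in x0 *; pose H0 := induced S.
pose H := @induced H0 (component x0); rewrite -[induced _]/H.
pose col (x : H) := c (val (val x)).
have colE (x : H) : (col x == i) || (col x == j).
  by rewrite /col; have := valP (val x); rewrite inE !ffunE.
have col3 (x y z : H) : adj x y -> adj y z -> col x = col z.
  have pcol (u v : H) : adj u v -> col u <> col v by move=> /pc/eqP.
  move=> /pcol xy /pcol yz.
  by case/orP: (colE x) => /eqP ?; case/orP: (colE y) => /eqP ?;
    case/orP: (colE z) => /eqP ?; congruence.
have nP4 (a b x y : H) : adj a b -> adj b x -> adj x y -> a != x -> b != y -> False.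
  move=> ab bx xy ax by'; apply: (noP4 (val (val a)) (val (val b)) (val (val x)) (val (val y))) => //.
  - exact: col3 bx.
  - exact: col3 xy.
(* The centre [u] is a vertex with two distinct neighbours if there is one, and otherwise [x0],
   whose component then has at most one edge. *)
have [u uP] : exists u : H, forall y z : H, adj u y -> adj y z -> z = u.
  have [/existsP[u /existsP[y /existsP[z /and3P[uy uz yz]]]]|no] :=
    boolP [exists u : H, exists y : H, exists z : H, [&& adj u y, adj u z & y != z]].
  - exists u => v w uv vw; apply/eqP/negPn/negP=> wu.
    have [z' [uz' vz']] : exists z', adj u z' /\ v != z'.
      by case: (eqVneq v y) => [->|vy]; [exists z | exists y].
    by apply: (nP4 w v u z') => //; rewrite adj_sym.
  - have x0c : x0 \in component x0 by rewrite inE connect0.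
    exists (exist _ x0 x0c : H) => y z uy yz; apply/eqP/negPn/negP=> zu.
    move/existsPn/(_ y)/existsPn/(_ z)/existsPn: no => /(_ (exist _ x0 x0c : H)).
    by rewrite yz zu adj_sym uy.
have allu (x : H) : x = u \/ adj u x.
  have /connectP[p pp ->] := @connect_component H0 x0 u x.
  elim/last_ind: p pp => [|p y IH] /=; first by left.
  rewrite rcons_path last_rcons => /andP[/IH[->|ul] ly]; first by right.
  by left; apply: uP ul ly.
apply/existsP; exists u; apply/forallP=> x; apply/forallP=> y; apply/eqP.
have [->|xy] := eqVneq x y; first by rewrite adj_irrefl.
case: (allu x) xy => [->|ux] xy; first by case: (allu y) xy => [->|->]; rewrite ?eqxx.
case: (allu y) xy => [->|uy] xy; first by rewrite eqxx orbT adj_sym ux.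
have /negPf-> : x != u by apply: contraTneq ux => ->; rewrite adj_irrefl.
have /negPf-> : y != u by apply: contraTneq uy => ->; rewrite adj_irrefl.
apply/negP=> /(uP _ _ ux) yu; by rewrite yu adj_irrefl in uy.
Qed.

(** The four vertices lie in one component, and the disjoint edges [a b] and [x y] cannot both
    contain the centre of a star. *)
Lemma star_coloring_noP4 (G : sgraph) (k : nat) (c : {ffun G -> 'I_k}) (a b x y : G) :
  star_coloring c -> adj a b -> adj b x -> adj x y -> a != x -> b != y ->
  c a = c x -> c b = c y -> False.
Proof.
case/andP=> /forallP pc /forallP st ab bx xy ax by' cax cby.
have cab : c a != c b by move: (pc a) => /forallP/(_ b)/implyP; apply.
have /forallP sf := implyP (forallP (st (c a)) (c b)) cab.
set S := [set x | _] in sf.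
have aS : a \in S by rewrite inE eqxx.
have bS : b \in S by rewrite inE eqxx orbT.
have xS : x \in S by rewrite inE cax eqxx.
have yS : y \in S by rewrite inE cby eqxx orbT.
pose i z (zS : z \in S) : induced S := exist _ z zS.
have cb : i b bS \in component (i a aS) by rewrite inE; apply: connect1.
have cx : i x xS \in component (i a aS).
  by move: cb; rewrite !inE => /connect_trans; apply; apply: connect1.
have cy : i y yS \in component (i a aS).
  by move: cx; rewrite !inE => /connect_trans; apply; apply: connect1.
have ca : i a aS \in component (i a aS) by rewrite inE connect0.
pose j z (zS : z \in component (i a aS)) : induced (component (i a aS)) := exist _ z zS.
have /existsP[u /forallP hu] := sf (i a aS).
have /forallP/(_ (j _ cb))/eqP := hu (j _ ca).
have /forallP/(_ (j _ cy))/eqP := hu (j _ cx).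
have E z w (zS : z \in S) (wS : w \in S) zc wc : (j (i z zS) zc == j (i w wS) wc) = (z == w) by [].
have adjE z w (zS : z \in S) (wS : w \in S) zc wc : adj (j (i z zS) zc) (j (i w wS) wc) = adj z w by [].
rewrite !adjE ab xy => /esym/andP[_ /orP[]/eqP<-] /esym/andP[_]; rewrite !E.
  rewrite (negPf ax) /= => /eqP bx'; by rewrite bx' adj_irrefl in bx.
rewrite (negPf by') orbF => /eqP ay; by rewrite ay -cby eqxx in cab.
Qed.

Lemma chi_s_leq (G : sgraph) (k : nat) : star_colorable G k -> chi_s G <= k.
Proof. by rewrite /chi_s; case: ex_minnP => m _ h /h. Qed.

Lemma chi_s_colorable (G : sgraph) : star_colorable G (chi_s G).
Proof. by rewrite /chi_s; case: ex_minnP. Qed.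

(** * Ramsey arguments *)

Definition nbr (G : sgraph) (x : G) : {set G} := [set y | adj x y].

Definition independent (G : sgraph) (A : {set G}) : Prop :=
  {in A &, forall x y, ~~ adj x y}.

Definition complete_between (G : sgraph) (A B : {set G}) : Prop :=
  forall x y, x \in A -> y \in B -> adj x y.

Lemma ramsey (G : sgraph) (a b : nat) (X : {set G}) : 2 ^ (a + b) <= #|X| ->
  (exists K : {set G}, [/\ K \subset X, clique K & #|K| = a]) \/
  (exists I : {set G}, [/\ I \subset X, independent I & #|I| = b]).
Proof.
have [n] := ubnP (a + b); elim: n a b X => // n IH [|a] [|b] X abn Xab.
- by left; exists set0; rewrite sub0set cards0; split=> //; apply/forallP=> x; rewrite inE.
- by left; exists set0; rewrite sub0set cards0; split=> //; apply/forallP=> x; rewrite inE.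
- by right; exists set0; rewrite sub0set cards0; split=> // x; rewrite inE.
have /card_gt0P[x xX] : 0 < #|X| by apply: leq_trans Xab; rewrite expn_gt0.
pose N1 := [set y in X | adj x y]; pose N2 := [set y in X :\ x | ~~ adj x y].
have cardX : #|X| = (#|N1| + #|N2|).+1.
  rewrite (cardsD1 x) xX add1n; congr _.+1.
  rewrite -(cardsID (nbr x) (X :\ x)); congr (_ + _); apply: eq_card => y; rewrite !inE.
  - by case: eqVneq => [->|_] //=; rewrite adj_irrefl andbF.
  - by rewrite andbC.
(* Without [x] at least [2 ^ (a + b + 2) - 1] vertices remain, so one of the two classes has
   [2 ^ (a + b + 1)]. *)
have /orP[h|h] : (2 ^ (a + b.+1) <= #|N1|) || (2 ^ (a.+1 + b) <= #|N2|).
  move: Xab; rewrite cardX addSn addnS expnS addSn.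
  by case: (leqP (2 ^ _) #|N1|) => //= h1; case: leqP => //= h2; lia.
- have [[K [KN cK Ka]]|[I [IN iI Ib]]] := IH a b.+1 N1 ltac:(lia) h.
    have xK : x \notin K by apply/negP=> /(subsetP KN); rewrite inE adj_irrefl andbF.
    left; exists (x |: K); split; last by rewrite cardsU1 xK Ka.
      apply/subsetP=> y; rewrite in_setU1 => /predU1P[->//|/(subsetP KN)].
      by rewrite inE => /andP[].
    have xN y : y \in K -> adj x y by move/(subsetP KN); rewrite inE => /andP[].
    apply/forall_inP=> y /setU1P[->|yK]; apply/forall_inP=> z /setU1P[->|zK].
    + by rewrite eqxx.
    + by rewrite xN ?implybT.
    + by rewrite adj_sym xN ?implybT.
    + by move/forall_inP/(_ y yK)/forall_inP/(_ z zK): cK.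
  right; exists I; split=> //; apply: subset_trans IN _.
  by apply/subsetP=> y; rewrite inE => /andP[].
- have [[K [KN cK Ka]]|[I [IN iI Ib]]] := IH a.+1 b N2 ltac:(lia) h.
    left; exists K; split=> //; apply: subset_trans KN _.
    by apply/subsetP=> y; rewrite !inE => /andP[/andP[]].
  have xI : x \notin I by apply/negP=> /(subsetP IN); rewrite !inE eqxx.
  right; exists (x |: I); split; last by rewrite cardsU1 xI Ib.
    apply/subsetP=> y; rewrite in_setU1 => /predU1P[->//|/(subsetP IN)].
    by rewrite !inE => /andP[/andP[]].
  have xN y : y \in I -> ~~ adj x y by move/(subsetP IN); rewrite inE => /andP[].
  move=> y z /setU1P[->|yI] /setU1P[->|zI]; first by rewrite adj_irrefl.
  + exact: xN.
  + by rewrite adj_sym xN.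
  + exact: iI.
Qed.

Lemma ramsey_omega (G : sgraph) (t : nat) (X : {set G}) : 2 ^ ((omega G).+1 + t) <= #|X| ->
  exists I : {set G}, [/\ I \subset X, independent I & #|I| = t].
Proof.
case/ramsey=> // -[K [_ cK Kw]].
have : #|K| <= omega G by apply: (leq_bigmax_cond (F := fun A : {set G} => #|A|)).
by rewrite Kw ltnn.
Qed.

Lemma induced_Kbip (G : sgraph) (r t : nat) (A B : {set G}) :
  independent A -> independent B -> complete_between A B ->
  r <= #|A| -> t <= #|B| -> is_induced_subgraph (Kbip r t) G.
Proof.
move=> iA iB AB rA tB.
pose a (i : 'I_r) : G := enum_val (widen_ord rA i).
pose b (i : 'I_t) : G := enum_val (widen_ord tB i).
have aA i : a i \in A by apply: enum_valP.
have bB i : b i \in B by apply: enum_valP.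
exists (fun u : Kbip r t => match u with inl i => a i | inr j => b j end); split.
  move=> [i|i] [j|j] E.
  - by congr inl; apply: val_inj; have /(congr1 val) := enum_val_inj E.
  - by have := AB _ _ (aA i) (bB j); rewrite E adj_irrefl.
  - by have := AB _ _ (aA j) (bB i); rewrite E adj_irrefl.
  - by congr inr; apply: val_inj; have /(congr1 val) := enum_val_inj E.
move=> [i|i] [j|j] /=.
- exact: negbTE (iA _ _ (aA i) (aA j)).
- exact: AB.
- by rewrite adj_sym AB.
- exact: negbTE (iB _ _ (bB i) (bB j)).
Qed.

(** The sides may carry edges; Ramsey's theorem inside each yields independent sets of size [t],
    enough for [Kbip r t] as [r <= t]. *)
Lemma Kbip_free_biclique (G : sgraph) (r t : nat) (A B : {set G}) :
  free (Kbip r t) G -> r <= t -> complete_between A B ->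
  2 ^ ((omega G).+1 + t) <= #|A| -> 2 ^ ((omega G).+1 + t) <= #|B| -> False.
Proof.
move=> fG rt AB /ramsey_omega[A' [A'A iA A't]] /ramsey_omega[B' [B'B iB B't]].
apply: fG; apply: (induced_Kbip iA iB); rewrite ?A't ?B't // => x y xA yB.
by apply: AB; [apply: (subsetP A'A) | apply: (subsetP B'B)].
Qed.

Lemma K1t_free_degree (G : sgraph) (t : nat) (x : G) :
  free (Kbip 1 t) G -> #|nbr x| < 2 ^ ((omega G).+1 + t).
Proof.
move=> fG; rewrite ltnNge; apply/negP=> /ramsey_omega[I [IN iI It]].
apply: fG; apply: (@induced_Kbip _ _ _ [set x] I) => //; rewrite ?cards1 ?It //.
  by move=> y z /set1P-> /set1P->; rewrite adj_irrefl.
by move=> y z /set1P-> /(subsetP IN); rewrite inE.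
Qed.

Lemma card_bigcup_leq (I T : finType) (A : {set I}) (F : I -> {set T}) :
  #|\bigcup_(i in A) F i| <= \sum_(i in A) #|F i|.
Proof.
elim/big_rec2: _ => [|i n B _ h]; first by rewrite cards0.
by rewrite (leq_trans (leq_card_setU _ _)) // leq_add2l.
Qed.

(** [e] is adjacency in the square of the graph. Properly colouring the square separates [a] and [x]
    on every path [a b x y]. *)
Lemma chi_s_max_degree (G : sgraph) (d : nat) :
  (forall x : G, #|nbr x| <= d) -> chi_s G <= (d + d * d).+2.
Proof.
move=> dG; pose e : rel G := fun x y => (x != y) && (y \in nbr x :|: \bigcup_(z in nbr x) nbr z).
have eP (x z y : G) : adj x z -> adj z y -> x != y -> e x y.
  move=> xz zy xy; rewrite /e xy !inE; apply/orP; right.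
  by apply/bigcupP; exists z; rewrite inE.
have esym : symmetric e.
  suff h x y : e x y -> e y x by move=> x y; apply/idP/idP; apply: h.
  case/andP=> xy /setUP[]; first by rewrite /e !inE eq_sym xy adj_sym => ->.
  case/bigcupP=> z; rewrite !inE => xz zy.
  by apply: (eP _ z); rewrite 1?adj_sym // eq_sym.
have eirr : irreflexive e by move=> x; rewrite /e eqxx.
have /degenerate_coloring[] // : degenerate e (d + d * d).+1.
  apply/forallP=> X; apply/implyP=> /set0Pn[x xX]; apply/exists_inP; exists x => //.
  rewrite ltnS (@leq_trans #|nbr x :|: \bigcup_(z in nbr x) nbr z|) //.
    by apply: subset_leq_card; apply/subsetP=> y; rewrite inE => /and3P[].
  rewrite (leq_trans (leq_card_setU _ _)) // leq_add //.
  rewrite (leq_trans (card_bigcup_leq _ _)) //.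
  rewrite (@leq_trans (\sum_(z in nbr x) d)) //; first exact: leq_sum.
  by rewrite sum_nat_const leq_mul2r dG orbT.
move=> c hc; apply: chi_s_leq; apply: (star_coloringI (c := c)) => [x y xy|].
  by apply: hc; rewrite /e !inE xy andbT; apply: contraTneq xy => ->; rewrite adj_irrefl.
by move=> a b x y ab bx xy ax _ cax; have := hc _ _ (eP _ _ _ ab bx ax); rewrite cax eqxx.
Qed.

(** * Forests in subdivided trees *)

(** If all degrees inside [X] were at least 2, every path in [X] could be prolonged at its first
    vertex: a neighbour other than the next vertex is new, as otherwise it closes a cycle. *)
Lemma forest_degenerate (G : sgraph) : forest G -> degenerate (@adj G) 2.
Proof.
move=> fG; apply/negPn/negP=> /degeneratePn[X X0 dX].
have [x0 x0X] := set0Pn _ X0.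
suff /(_ #|G|)[x [p [pp up _ sp]]] : forall n, exists x p,
    [/\ path (@adj G) x p, uniq (x :: p), {subset x :: p <= X} & size p = n].
  by have := max_card (mem (x :: p)); rewrite (card_uniqP up) /= sp ltnn.
elim=> [|n [x [p [pp up sub sp]]]].
  by exists x0, [::]; split=> // y; rewrite inE => /eqP->.
have xX : x \in X by apply: sub; rewrite mem_head.
have [y xy yp] : exists2 y, y \in [set y in X | adj x y] & y \notin x :: p.
  apply/exists_inP; apply: contraT => /exists_inPn h.
  have sNp y : y \in [set y in X | adj x y] -> y \in p.
    move=> yN; move: (h y yN); rewrite negbK inE => /predU1P[yx|//].
    by move: yN; rewrite yx inE adj_irrefl andbF.
  have [y yN yh] : exists2 y, y \in [set y in X | adj x y] & y != head x p.
    apply/exists_inP; apply: contraT => /exists_inPn h'.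
    have := dX x xX; rewrite leqNgt ltnS -(cards1 (head x p)) => /negP[].
    by apply: subset_leq_card; apply/subsetP=> y yN; rewrite inE; move: (h' y yN); rewrite negbK.
  have xy : adj x y by move: yN; rewrite inE => /andP[].
  have yp := sNp y yN.
  case/splitPr: p / yp pp up yh {h sub sp sNp} => p1 p2 pp up yh.
  have := fG (x :: rcons p1 y); rewrite /ucycle /= rcons_path last_rcons adj_sym xy andbT.
  move: pp up; rewrite -cat_rcons cat_path -cat_cons cat_uniq => /andP[-> _] /andP[/= -> _].
  rewrite size_rcons => /(_ isT); case: p1 yh => // /=; by rewrite eqxx.
move: xy; rewrite inE => /andP[yX xy]; exists y, (x :: p); split=> //=.
- by rewrite adj_sym xy.
- by rewrite yp.
- by move=> z /predU1P[->//|]; apply: sub.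
- by rewrite sp.
Qed.

(* A rooted tree on [{0, ..., n - 1}] is given by a parent function [p] with
   [p i < i]; its root is [0] and its edges are indexed by their lower ends
   [0 < i < n]. In its 1-subdivision, the branch vertex [i] is adjacent to the
   subdivision vertex [j] iff [incident p i j]. *)
Definition parent_fun (p : nat -> nat) := forall i, 0 < i -> p i < i.

Definition incident (p : nat -> nat) (i j : nat) : bool := (i == j) || (i == p j).

(* [A] holds the vertices of [T] placed on branch vertices. *)
Definition subdiv_embedding (T : sgraph) (A X : {set T}) p n (f : T -> nat) : Prop :=
  [/\ {in X, forall v, f v < n},
      {in X, forall v, v \notin A -> 0 < f v},
      {in X &, forall v w, (v \in A) = (w \in A) -> f v = f w -> v = w} &
      {in X &, forall a b, a \in A -> b \notin A -> adj a b = incident p (f a) (f b)}].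

Section Embedding.

Variables (T : sgraph) (A : {set T}).
Hypothesis bipA : forall x y : T, adj x y -> (x \in A) != (y \in A).
Hypothesis degA : forall x : T, x \notin A -> #|nbr x| <= 2.

Let nn (p : nat -> nat) n q i := if i == n then 0 else if i == n.+1 then q else p i.

Let nn_parent p n q : parent_fun p -> 0 < n -> q <= n -> parent_fun (nn p n q).
Proof.
move=> pp n0 qn i i0; rewrite /nn; case: eqP => [_//|_].
by case: eqP => [->|_]; [rewrite ltnS | apply: pp].
Qed.


(* The new branch vertex [n] hangs below the root and carries nothing: taking it as the
   parent [q] of [n + 1] isolates what is put on [n + 1] and on the edge above it. The set
   [Z], with at most one vertex on each side, is moved there. *)
Let extend (X Z : {set T}) (x : T) p n f q :
  parent_fun p -> 0 < n -> q <= n -> subdiv_embedding A (X :\ x) p n f ->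
  x \in Z -> {in Z &, forall v w, (v \in A) = (w \in A) -> v = w} ->
  (forall a b, a \in X :\: Z -> b \in X :&: Z -> a \in A -> b \notin A -> adj a b = (f a == q)) ->
  (forall a b, a \in X :&: Z -> b \in X :\: Z -> a \in A -> b \notin A -> adj a b = false) ->
  (forall a b, a \in X :&: Z -> b \in X :&: Z -> a \in A -> b \notin A -> adj a b) ->
  exists p n f, [/\ parent_fun p, 0 < n & subdiv_embedding A X p n f].
Proof.
move=> pp n0 qn [fn f0 finj fE] xZ Zinj Eq E0 E1.
have nnE i : i < n -> nn p n q i = p i.
  by rewrite /nn; case: eqP => [->|_]; [lia|]; case: eqP => [->|_] //; lia.
have nnS : nn p n q n.+1 = q by rewrite /nn eqxx; case: eqP => //; lia.
have XZ y : y \in X -> y \notin Z -> y \in X :\ x.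
  by move=> yX yZ; rewrite !inE yX andbT; apply: contraNneq yZ => ->.
have XD y : y \in X -> y \notin Z -> y \in X :\: Z by move=> yX yZ; rewrite inE yX yZ.
have XI y : y \in X -> y \in Z -> y \in X :&: Z by move=> yX yZ; rewrite inE yX yZ.
exists (nn p n q), n.+2, (fun y => if y \in Z then n.+1 else f y); split=> //.
  exact: nn_parent.
split=> [v vX|v vX vA|v w vX wX|a b aX bX aA bA].
- by case: ifP => // /negbT vZ; have := fn _ (XZ _ vX vZ); lia.
- by case: ifP => // /negbT vZ; apply: f0; rewrite ?XZ.
- case: ifP => [vZ|/negbT vZ]; case: ifP => [wZ|/negbT wZ] vw E.
  + exact: Zinj.
  + by have := fn _ (XZ _ wX wZ); lia.
  + by have := fn _ (XZ _ vX vZ); lia.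
  + by apply: finj => //; apply: XZ.
case: ifP => [aZ|/negbT aZ]; case: ifP => [bZ|/negbT bZ].
- by rewrite /incident eqxx E1 // XI.
- rewrite E0 ?XI ?XD // /incident.
  have fb := fn _ (XZ _ bX bZ); have := pp _ (f0 _ (XZ _ bX bZ) bA).
  by rewrite nnE //; case: eqP => //=; [lia|]; case: eqP => //; lia.
- rewrite (Eq _ b) ?XI ?XD // /incident nnS.
  by have := fn _ (XZ _ aX aZ); case: (f a =P n.+1) => //= ->; lia.
- rewrite fE ?XZ // /incident nnE //; exact/fn/XZ.
Qed.

(** [q] is the place of the only remaining neighbour of [z], or the vacant branch vertex [n] if
    there is none. *)
Let pick_parent (X : {set T}) p n f z : subdiv_embedding A X p n f ->
  z \notin A -> (forall a b, a \in X -> b \in X -> adj a z -> adj b z -> a = b) ->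
  exists2 q, q <= n & forall a, a \in X -> a \in A -> adj a z = (f a == q).
Proof.
move=> [fn f0 finj fE] zA uniqz.
case: (pickP [pred a | (a \in X) && adj a z]) => [a /andP[aX az]|no]; last first.
  exists n => // a aX aA; have := no a; rewrite /= aX => /= ->.
  by have := fn _ aX; case: eqP => // ->; rewrite ltnn.
exists (f a) => [|b bX bA]; first exact/ltnW/fn.
apply/idP/eqP => [bz|fba]; first by congr f; apply: uniqz.
rewrite (finj b a) // bA; have := bipA az; rewrite (negPf zA); by case: (a \in A).
Qed.

(** Induction removes a vertex [x] with at most one remaining neighbour. Outside [A], it is put on a
    new edge hung at that neighbour. If [x] is in [A] and has the neighbour [b], then [b] has at
    most one other neighbour, and [b] moves onto a new edge from there to [x]. *)
Lemma forest_subdiv_embedding : forest T ->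
  exists p n f, [/\ parent_fun p, 0 < n & subdiv_embedding A [set: T] p n f].
Proof.
move/forest_degenerate=> dT; move: [set: T]; apply: (degenerate_ind dT) => [|X x xX xd].
  exists predn, 1, (fun=> 0); split=> //; first by case.
  by split=> [v|v|v w|v w]; rewrite inE.
case=> p [n [f [pp n0 emb]]].
have nbr1 y z : y \in X -> z \in X -> adj x y -> adj x z -> y = z.
  move=> yX zX xy xz; apply/eqP/negPn/negP=> yz.
  move: xd; rewrite ltnNge -[1.+1]/(true.+1) -yz -cards2 => /negP[].
  by apply: subset_leq_card; apply/subsetP=> w; rewrite !inE => /orP[]/eqP->; apply/andP.
have sX y : y \in X :\ x -> y \in X by rewrite inE => /andP[].
have [xA|xA] := boolP (x \in A); last first.
  have [|q qn qE] := pick_parent emb xA.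
    by move=> a b /sX aX /sX bX; rewrite ![adj _ x]adj_sym; apply: nbr1.
  apply: (extend (x := x) (Z := [set x]) (q := q) pp n0 qn emb); rewrite ?set11 //.
  - by move=> v w /set1P-> /set1P->.
  - move=> a b aX /setIP[_ /set1P->] aA _; exact: qE.
  - by move=> a b /setIP[_ /set1P->] _ aA; rewrite aA in xA.
  - by move=> a b /setIP[_ /set1P->] _ aA; rewrite aA in xA.
case: (pickP [pred b | (b \in X) && adj x b]) => [b /andP[bX xb]|no]; last first.
  apply: (extend (x := x) (Z := [set x]) (q := n) pp n0 (leqnn n) emb); rewrite ?set11 //.
  - by move=> v w /set1P-> /set1P->.
  - by move=> a b _ /setIP[_ /set1P->] _; rewrite xA.
  - by move=> a b /setIP[_ /set1P->] /setDP[bX _] _ _; have := no b; rewrite /= bX.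
  - by move=> a b _ /setIP[_ /set1P->] _; rewrite xA.
have bA : b \notin A by have := bipA xb; rewrite xA; case: (b \in A).
have [|q qn qE] := pick_parent emb bA.
  move=> a a' /setD1P[ax aX] /setD1P[a'x a'X] ab a'b; apply/eqP/negPn/negP=> aa'.
  have := degA bA; rewrite leqNgt => /negP[].
  have <- : #|[set x; a; a']| = 3 by rewrite setUC cardsU1 cards2 !inE negb_or a'x eq_sym aa' eq_sym ax.
  apply: subset_leq_card; apply/subsetP=> w; rewrite !inE.
  by case/orP=> [/orP[]|] /eqP->; rewrite adj_sym.
have xbb : x != b by apply: contraTneq xb => ->; rewrite adj_irrefl.
apply: (extend (x := x) (Z := [set x; b]) (q := q) pp n0 qn emb); rewrite ?set21 //.
- by move=> v w /set2P[]-> /set2P[]-> //; rewrite xA (negPf bA).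
- move=> a c /setDP[aX aZ] /setIP[_ /set2P[]->] aA; rewrite ?xA // => _.
  by apply: qE => //; move: aZ; rewrite !inE negb_or aX => /andP[->].
- move=> a c /setIP[_ /set2P[]->] /setDP[cX cZ] aA cA; last by rewrite aA in bA.
  apply: contraNF cZ => xc; rewrite (nbr1 c b) //; exact: set22.
- by move=> a c /setIP[_ /set2P[]->] /setIP[_ /set2P[]->]; rewrite ?xA // (negPf bA).
Qed.

End Embedding.

(** * Trees given by parent functions *)

Section ParentTree.

Variables (p : nat -> nat) (n : nat).
Hypothesis pp : parent_fun p.

Definition parent_adj : rel 'I_n.+1 := fun i j =>
  ((0 < i) && (p i == j)) || ((0 < j) && (p j == i)).

Lemma parent_adj_sym : symmetric parent_adj.
Proof. by move=> i j; rewrite /parent_adj orbC. Qed.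

Lemma parent_adj_irrefl : irreflexive parent_adj.
Proof.
by move=> i; rewrite /parent_adj orbb; apply/negP=> /andP[/pp + /eqP E]; rewrite E ltnn.
Qed.

Definition parent_tree : sgraph := SGraph parent_adj_sym parent_adj_irrefl.

(** On a cycle, both neighbours of the largest vertex would be its parent. Descending along parents
    reaches the root, whence connectivity. *)
Lemma parent_tree_tree : tree parent_tree.
Proof.
split; last split.
- move=> c /andP[cc uc]; rewrite leqNgt; apply/negP=> c3.
  have [m mc mmax] : exists2 m : 'I_n.+1, m \in c & forall i : 'I_n.+1, i \in c -> i <= m.
    case: c c3 {cc uc} => // a c _.
    have [i ic imax] := @arg_maxnP _ a (mem (a :: c)) (@nat_of_ord n.+1) (mem_head _ _).
    by exists i.
  have [k c' Ec] := rot_to mc.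
  have : cycle (@adj parent_tree) (m :: c') by rewrite -Ec rot_cycle.
  have uc' : uniq (m :: c') by rewrite -Ec rot_uniq.
  have : size (m :: c') = size c by rewrite -Ec size_rot.
  have {}mmax i : i \in m :: c' -> i <= m by rewrite -Ec mem_rot; apply: mmax.
  have adjm i : i \in m :: c' -> parent_adj m i -> nat_of_ord i = p m.
    move=> /mmax im /orP[/andP[_ /eqP->//]|/andP[/pp + /eqP E]]; rewrite E; lia.
  case: c' uc' mmax adjm {Ec} => [|y c'] uc' _ adjm /= sc; first by rewrite -sc in c3.
  case/andP=> my; case/lastP: c' uc' adjm sc => [|c' z] uc' adjm sc; first by rewrite -sc in c3.
  rewrite rcons_path last_rcons => /andP[_ zm].
  have Ey : nat_of_ord y = p m by apply: adjm; rewrite // !inE eqxx orbT.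
  have Ez : nat_of_ord z = p m.
    by apply: adjm; [rewrite !inE mem_rcons mem_head !orbT | rewrite parent_adj_sym].
  have yz : y = z by apply: val_inj; rewrite /= Ey Ez.
  by move: uc' => /= /and3P[_]; rewrite yz mem_rcons mem_head.
- by rewrite card_ord.
- have csym := sym_connect_sym (@adj_sym parent_tree).
  suff h (i : 'I_n.+1) : connect (@adj parent_tree) ord0 i.
    by move=> i j; apply: connect_trans (h j); rewrite csym.
  case: i => i; have [k] := ubnP i; elim: k i => // k IH [|i] ik isn.
    by rewrite (_ : Ordinal isn = ord0) ?connect0 //; apply: val_inj.
  have pi : p i.+1 < i.+1 by apply: pp.
  have pin : p i.+1 < n.+1 by apply: ltn_trans isn.
  apply: connect_trans (IH _ _ pin) (connect1 _); first exact: leq_trans pi _.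
  by apply/orP; right => /=.
Qed.

(** A vertex [v] outside [A] goes to the edge from [f v] to its parent, which exists as [f v] is
    positive. As parents are smaller, this edge determines [f v]. *)
Lemma subdiv_embedding_subgraph (T : sgraph) (A : {set T}) f :
  (forall x y : T, adj x y -> (x \in A) != (y \in A)) ->
  subdiv_embedding A [set: T] p n.+1 f -> is_subgraph T (subdivision parent_tree).
Proof.
move=> bipA [fn f0 finj fE].
have {}fn v : f v < n.+1 by apply: fn.
pose s v : 'I_n.+1 := inord (f v); pose ps v : 'I_n.+1 := inord (p (f v)).
have sE v : s v = f v :> nat by rewrite inordK.
have pE v : v \notin A -> ps v = p (f v) :> nat.
  by move=> vA; rewrite inordK // (ltn_trans (pp (f0 _ (in_setT v) vA))).
have edgeP v : v \notin A -> [set s v; ps v] \in edges parent_tree.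
  move=> vA; rewrite inE; apply/existsP; exists (s v); apply/existsP; exists (ps v).
  by rewrite eqxx andbT; apply/orP; left; rewrite sE pE // eqxx f0.
pose g v : subdivision parent_tree :=
  match boolP (v \in A) with
  | AltTrue _ => inl (s v)
  | AltFalse vA => inr (exist _ [set s v; ps v] (edgeP v vA))
  end.
exists g; split=> [v w|v w vw]; rewrite /g.
  case: {-}_ / boolP => vA; case: {-}_ / boolP => wA // E; apply: finj; rewrite ?inE //.
  - by rewrite vA wA.
  - by case: E => /(congr1 (@nat_of_ord _)); rewrite !sE.
  - by rewrite (negPf vA) (negPf wA).
  - have {E} E : [set s v; ps v] = [set s w; ps w] by case: E.
    have pv := pp (f0 _ (in_setT v) vA); have pw := pp (f0 _ (in_setT w) wA).
    have /set2P svw : s v \in [set s w; ps w] by rewrite -E set21.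
    have /set2P swv : s w \in [set s v; ps v] by rewrite E set21.
    case: svw => /(congr1 (@nat_of_ord _)); rewrite ?sE ?pE // => e1.
    by case: swv => /(congr1 (@nat_of_ord _)); rewrite ?sE ?pE // => e2; lia.
have := bipA _ _ vw.
case: {-}_ / boolP => vA; case: {-}_ / boolP => wA /=.
- by rewrite vA wA.
- by move: vw; rewrite fE ?inE // => /orP[]/eqP E _; rewrite -!val_eqE /= ?sE ?pE // E eqxx ?orbT.
- move: vw; rewrite adj_sym fE ?inE // => /orP[]/eqP E _; rewrite -!val_eqE /= ?sE ?pE // E eqxx ?orbT //.
- by rewrite (negPf vA) (negPf wA).
Qed.

End ParentTree.

(** * Subdivisions of complete graphs *)

Definition is_branch (S : sgraph) (u : subdivision S) : bool := if u is inl _ then true else false.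

Lemma subdivision_adj_branch (S : sgraph) (u v : subdivision S) :
  adj u v -> is_branch u != is_branch v.
Proof. by case: u v => [x|e] [y|f]. Qed.

Lemma edgesP (S : sgraph) (e : {set S}) : e \in edges S ->
  exists x y, adj x y /\ e = [set x; y].
Proof. by rewrite inE => /existsP[x /existsP[y /andP[xy /eqP->]]]; exists x, y. Qed.

Lemma edges_card (S : sgraph) (e : {set S}) : e \in edges S -> #|e| <= 2.
Proof. by case/edgesP=> x [y [_ ->]]; rewrite cards2; case: eqP. Qed.

Lemma edges_eq2 (S : sgraph) (e : {set S}) (x y : S) :
  e \in edges S -> x != y -> x \in e -> y \in e -> e = [set x; y].
Proof.
move=> eS xy xe ye; apply/esym/eqP; rewrite eqEcard cards2 xy edges_card // andbT.
by apply/subsetP=> z /set2P[]->.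
Qed.

Lemma subdivision_bipartition (T S : sgraph) : is_subgraph T (subdivision S) ->
  exists A : {set T}, (forall x y : T, adj x y -> (x \in A) != (y \in A)) /\
    (forall x : T, x \notin A -> #|nbr x| <= 2).
Proof.
case=> f [injf adjf]; exists [set x | is_branch (f x)]; split=> x.
  by move=> y /adjf/subdivision_adj_branch; rewrite !inE.
rewrite inE; case fx: (f x) => [//|[e eS]] _; rewrite -(card_imset _ injf).
apply: leq_trans (edges_card eS); rewrite -(card_imset (mem e) (inl_inj (B := {e : {set S} | e \in edges S}))).
apply: subset_leq_card; apply/subsetP=> _ /imsetP[y + ->]; rewrite inE => /adjf.
by rewrite fx; case: (f y) => // z ze; apply: imset_f.
Qed.

Lemma omega_subdivision (S : sgraph) : omega (subdivision S) <= 2.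
Proof.
apply/bigmax_leqP=> A /forall_inP cA; rewrite -card_bool.
apply: (@leq_card_in _ _ (@is_branch S)).
move=> u v uA vA; apply: contra_eq => uv.
by move/forall_inP/(_ v vA)/implyP/(_ uv)/subdivision_adj_branch: (cA u uA).
Qed.

(** The biclique contains a 4-cycle, on which two branch vertices would be the ends of two different
    edges. *)
Lemma subdivision_Kbip_free (S : sgraph) (r t : nat) :
  1 < r -> 1 < t -> free (Kbip r t) (subdivision S).
Proof.
move=> r1 t1 [f [injf adjf]].
pose u0 : Kbip r t := inl (Ordinal (ltnW r1)); pose u1 : Kbip r t := inl (Ordinal r1).
pose v0 : Kbip r t := inr (Ordinal (ltnW t1)); pose v1 : Kbip r t := inr (Ordinal t1).
have C4 (a b c d : subdivision S) : is_branch a -> a != b -> c != d ->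
    adj a c -> adj a d -> adj b c -> adj b d -> False.
  case: a => // x; case: b => [y|?]; case: c => // -[e eS]; case: d => // -[e' eS'] _ xy ee' //= xe xe' ye ye'.
  have {}xy : x != y by apply: contra_neq xy => ->.
  move/eqP: ee'; apply; congr inr; apply: val_inj => /=.
  by rewrite (edges_eq2 eS xy) // (edges_eq2 eS' xy).
have u01 : f u0 != f u1 by rewrite inj_eq.
have v01 : f v0 != f v1 by rewrite inj_eq.
have uv (u v : Kbip r t) : adj u v -> adj (f u) (f v) by rewrite adjf.
case bu0: (is_branch (f u0)); first by apply: (C4 _ _ _ _ bu0 u01 v01); apply: uv.
apply: (C4 _ _ _ _ _ v01 u01); try exact: uv.
by have := subdivision_adj_branch (uv u0 v0 isT); rewrite bu0; case: is_branch.
Qed.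

Definition complete_adj n : rel 'I_n := fun x y => x != y.

Lemma complete_adj_sym n : symmetric (@complete_adj n).
Proof. by move=> x y; rewrite /complete_adj eq_sym. Qed.

Lemma complete_adj_irrefl n : irreflexive (@complete_adj n).
Proof. by move=> x; rewrite /complete_adj eqxx. Qed.

Definition complete n : sgraph := SGraph (@complete_adj_sym n) (@complete_adj_irrefl n).

Lemma pigeonhole (I : finType) (k m : nat) (c : I -> 'I_k) :
  k * m < #|I| -> exists i, m < #|[set x | c x == i]|.
Proof.
move=> kmI; apply/existsP; rewrite -[[exists _, _]]negbK; apply/negP=> /existsPn h.
move: kmI; rewrite ltnNge -sum1_card (partition_big c predT) //= => /negP[].
rewrite -[k in leqRHS]card_ord -sum_nat_const; apply: leq_sum => i _.
by rewrite sum1dep_card leqNgt h.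
Qed.

(** With [m] colours, some colour [i] occurs on more than [m] branch vertices. Fix one of them, [y]:
    the edges from [y] to the others avoid [i], so two of them, to [z] and [w], share a colour and
    give a bicoloured path. *)
Lemma chi_s_subdivision_complete n k : k * k < n -> k < chi_s (subdivision (complete n)).
Proof.
move=> kn; rewrite ltnNge; apply/negP=> chik; move: (chi_s_colorable (subdivision (complete n))).
set m := chi_s _ in chik * => /existsP[c sc].
have mn : m * m < #|'I_n| by rewrite card_ord (leq_ltn_trans _ kn) ?leq_mul.
have [i] := pigeonhole (fun x : 'I_n => c (inl (x : complete n))) mn.
set Y := [set x | _] => Ym.
have /card_gt0P[y yY] : 0 < #|Y| by apply: leq_ltn_trans Ym.
have edgeP (z : complete n) : z != y -> [set y; z] \in edges (complete n).
  move=> zy; rewrite inE; apply/existsP; exists y; apply/existsP; exists z.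
  by rewrite eqxx andbT /= /complete_adj eq_sym.
(* [e z] subdivides the edge from [y] to [z]; [inl y] is a filler for [z = y]. *)
pose e (z : complete n) : subdivision (complete n) :=
  match boolP (z != y) with
  | AltTrue zy => inr (exist _ [set y; z] (edgeP z zy))
  | AltFalse _ => inl y
  end.
have ez z : z != y -> adj (e z) (inl z) by rewrite /e => zy; case: {-}_ / boolP; rewrite ?zy //= !inE eqxx orbT.
have ey z : z != y -> adj (e z) (inl y) by rewrite /e => zy; case: {-}_ / boolP; rewrite ?zy //= !inE eqxx.
have einj z w : z != y -> w != y -> e z = e w -> z = w.
  rewrite /e => zy wy; case: {-}_ / boolP; rewrite ?zy // => ?; case: {-}_ / boolP; rewrite ?wy // => ? E.
  have {E}E : [set y; z] = [set y; w] by case: E.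
  have : z \in [set y; w] by rewrite -E set22.
  by case/set2P => // zy'; rewrite zy' eqxx in zy.
have ec z : z \in Y :\ y -> c (e z) \in [set~ i].
  move=> /setD1P[zy _]; rewrite !inE; move: yY; rewrite inE => /eqP <-.
  by move: sc => /andP[/forallP/(_ (e z))/forallP/(_ (inl y))/implyP pc _]; apply/pc/ey.
have : ~ {in Y :\ y &, injective (c \o e)}.
  move/card_in_imset=> E; have : #|(c \o e) @: (Y :\ y)| <= #|[set~ i]|.
    by apply: subset_leq_card; apply/subsetP=> _ /imsetP[z zY ->]; apply: ec.
  by rewrite E cardsC1 card_ord; move: Ym; rewrite (cardsD1 y Y) yY; have := ltn_ord i; lia.
apply=> z w /setD1P[zy zY] /setD1P[wy wY] /= czw; apply/eqP/negPn/negP=> zw.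
apply: (@star_coloring_noP4 _ _ c (inl z) (e z) (inl y) (e w) sc) => //.
- by rewrite adj_sym; apply: ez.
- exact: ey.
- by rewrite adj_sym; apply: ey.
- by apply: contra_neq zw; apply: einj.
- by move: zY yY; rewrite !inE => /eqP-> /eqP->.
Qed.

(** * Random images of trees *)

Section RandomHomomorphism.
Import Order.TTheory GRing.Theory Num.Theory.
Local Open Scope ring_scope.

Variables (G : sgraph) (X : {set G}) (p : nat -> nat) (D : nat).
Hypothesis pp : parent_fun p.
Hypothesis D0 : (0 < D)%N.

Definition nbr_in (x : G) : {set G} := [set y in X | adj x y].

Let d (x : G) : rat := #|nbr_in x|%:R.

Hypothesis degX : forall x, x \in X -> (D <= #|nbr_in x|)%N.

Definition assign (s : nat -> G) (n : nat) (y : G) : nat -> G :=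
  fun i => if i == n then y else s i.

(* Unnormalised expectation: the image of [0] is distributed proportionally to the degree,
   and the image of [i] is a uniform neighbour of the image of [p i]. *)
Fixpoint expect (n : nat) (F : (nat -> G) -> rat) : rat :=
  match n with
  | 0%N => \sum_(x in X) d x * F (fun=> x)
  | m.+1 => expect m (fun s =>
      (d (s (p n)))^-1 * \sum_(y in nbr_in (s (p n))) F (assign s n y))
  end.

Definition walk (n : nat) (s : nat -> G) : Prop :=
  (forall i, (i <= n)%N -> s i \in X) /\
  (forall i, (0 < i <= n)%N -> adj (s (p i)) (s i)).

Let le_parent n : (p n.+1 <= n)%N.
Proof. exact: (pp (ltn0Sn n)). Qed.

Let d_ge0 x : 0 <= d x. Proof. exact: ler0n. Qed.

Let d_gt0 x : x \in X -> 0 < d x.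
Proof. by move=> /degX; rewrite ltr0n; apply: leq_trans. Qed.

Let D_gt0 : 0 < D%:R :> rat. Proof. by rewrite ltr0n. Qed.

Let le_D_d x : x \in X -> D%:R <= d x.
Proof. by move=> /degX; rewrite ler_nat. Qed.

Lemma walkS n s y : walk n s -> y \in nbr_in (s (p n.+1)) -> walk n.+1 (assign s n.+1 y).
Proof.
move=> [sX se]; rewrite inE => /andP[yX ye]; split=> i.
  by rewrite /assign; case: eqP => // /eqP ni; rewrite leq_eqVlt (negPf ni) => /sX.
case/andP=> i0; rewrite leq_eqVlt => /predU1P[->|ni].
  by rewrite /assign eqxx; have := le_parent n; case: eqP => [->|//]; rewrite ltnn.
have := pp i0; rewrite /assign; do 2 case: eqP => [|_]; try lia.
by move=> _; apply: se; rewrite i0.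
Qed.

Lemma expect_le n F H : (forall s, walk n s -> F s <= H s) -> expect n F <= expect n H.
Proof.
elim: n F H => [|n IH] F H FH /=.
  apply: ler_sum => x xX; rewrite ler_wpM2l // FH //; split=> // i.
  by case: i.
apply: IH => s ws; rewrite ler_wpM2l ?invr_ge0 //; apply: ler_sum => y yN.
exact/FH/walkS.
Qed.

Lemma eq_expect n F H : (forall s, walk n s -> F s = H s) -> expect n F = expect n H.
Proof. by move=> FH; apply/le_anti; rewrite !expect_le // => s /FH->. Qed.

Lemma expect_sum n (I : Type) (r : seq I) (P : pred I) (F : I -> (nat -> G) -> rat) :
  expect n (fun s => \sum_(i <- r | P i) F i s) = \sum_(i <- r | P i) expect n (F i).
Proof.
elim: n F => [|n IH] F /=.
  by rewrite exchange_big; apply: eq_bigr => x _; rewrite mulr_sumr.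
rewrite -IH; apply: eq_expect => s _; rewrite exchange_big mulr_sumr.
by apply: eq_bigr.
Qed.

Lemma expectD n F H : expect n (fun s => F s + H s) = expect n F + expect n H.
Proof.
elim: n F H => [|n IH] F H /=.
  by rewrite -big_split; apply: eq_bigr => x _; rewrite mulrDr.
by rewrite -IH; apply: eq_expect => s _; rewrite big_split mulrDr.
Qed.

Lemma walk_sub n s i : walk n s -> (i <= n)%N -> s i \in X.
Proof. by case=> + _; apply. Qed.

Let expect_assign n F : (forall s y, F (assign s n.+1 y) = F s) ->
  expect n.+1 F = expect n F.
Proof.
move=> Fs /=; apply: eq_expect => s ws; rewrite (eq_bigr (fun=> F s)) //.
rewrite sumr_const -[F s *+ _]mulr_natl mulrA mulVf ?mul1r //.
by rewrite gt_eqF // d_gt0 // (walk_sub ws).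
Qed.

Let sum_nbr_swap (g : G -> G -> rat) :
  \sum_(x in X) \sum_(y in nbr_in x) g x y = \sum_(y in X) \sum_(x in nbr_in y) g x y.
Proof.
under eq_bigr => x _ do under eq_bigl => y do rewrite inE.
rewrite (exchange_big_dep (mem X)) /=; last by move=> x y _ /andP[].
apply: eq_bigr => y yX; apply: eq_bigl => x.
by rewrite inE yX adj_sym.
Qed.

Let sum_nbr_const x (c : rat) : \sum_(y in nbr_in x) c = d x * c.
Proof. by rewrite sumr_const mulr_natl. Qed.

Let sum_nbr_le x (g : G -> rat) : (forall y, 0 <= g y) ->
  \sum_(y in nbr_in x) g y <= \sum_(y in X) g y.
Proof.
move=> g0; rewrite [leLHS](eq_bigl (fun y => (y \in X) && adj x y)) => [|y]; last by rewrite inE.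
by rewrite big_mkcondr; apply: ler_sum => y _; case: ifP.
Qed.

(** The degree weights are stationary: a step to a uniform neighbour cancels the degree, and the
    remaining sum over adjacent pairs is symmetric. *)
Lemma expect_marginal n i (g : G -> rat) : (i <= n)%N ->
  expect n (fun s => g (s i)) = \sum_(x in X) d x * g x.
Proof.
elim: n i g => [|n IH] i g; first by rewrite leqn0 => /eqP->.
rewrite leq_eqVlt => /predU1P[->|ni]; last first.
  rewrite expect_assign ?IH // => s y; rewrite /assign; case: eqP => // E.
  by rewrite E ltnn in ni.
pose h w := (d w)^-1 * \sum_(y in nbr_in w) g y.
transitivity (expect n (fun s => h (s (p n.+1)))).
  by rewrite /=; apply: eq_expect => s _; congr (_ * _); apply: eq_bigr => y _; rewrite /assign eqxx.
rewrite IH //; transitivity (\sum_(x in X) \sum_(y in nbr_in x) g y).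
  by apply: eq_bigr => x xX; rewrite /h mulrA divff ?mul1r // gt_eqF // d_gt0.
by rewrite sum_nbr_swap; apply: eq_bigr => y yX; rewrite sum_nbr_const.
Qed.

(* Conditionally on the image of [i], the image of [j] hits any given vertex with
   probability at most [1 / D]: the last step of a walk between them does. For [j] an
   ancestor of [i] this uses that the walk is reversible. *)
Lemma expect_joint n i j (g : G -> G -> rat) :
  (i <= n)%N -> (j <= n)%N -> i != j -> (forall a b, 0 <= g a b) ->
  expect n (fun s => g (s i) (s j)) <= D%:R^-1 * \sum_(a in X) d a * \sum_(b in X) g a b.
Proof.
elim: n i j g => [|n IH] i j g.
  by rewrite !leqn0 => /eqP-> /eqP->.
have nle k : (k <= n)%N -> (k == n.+1) = false by move=> kn; apply/eqP => E; rewrite E ltnn in kn.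
rewrite leq_eqVlt ltnS => /predU1P[->|ni]; rewrite leq_eqVlt ltnS => /predU1P[->|nj] ij g0.
- by rewrite eqxx in ij.
- pose h w b := (d w)^-1 * \sum_(y in nbr_in w) g y b.
  have -> : expect n.+1 (fun s => g (s n.+1) (s j)) = expect n (fun s => h (s (p n.+1)) (s j)).
    by rewrite /=; apply: eq_expect => s _; congr (_ * _); apply: eq_bigr => y _; rewrite /assign eqxx nle.
  (* If [j] is the parent of the new vertex, swapping the sum over adjacent pairs makes the image of
     [j] a uniform neighbour of the image of the new vertex. *)
  have [pj|pj] := eqVneq (p n.+1) j.
    rewrite pj (expect_marginal (fun x => h x x)) //.
    have -> : \sum_(x in X) d x * h x x = \sum_(x in X) \sum_(y in nbr_in x) g y x.
      by apply: eq_bigr => x xX; rewrite /h mulrA divff ?mul1r // gt_eqF // d_gt0.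
    rewrite sum_nbr_swap mulr_sumr; apply: ler_sum => y yX; rewrite mulrA.
    apply: le_trans (sum_nbr_le y (g0 y)) _; rewrite -[leLHS]mul1r.
    by rewrite ler_wpM2r ?sumr_ge0 // mulrC ler_pdivlMr // mul1r le_D_d.
  have h0 a b : 0 <= h a b by rewrite mulr_ge0 ?invr_ge0 ?sumr_ge0.
  apply: le_trans (IH _ _ h (le_parent n) nj pj h0) _.
  rewrite ler_wpM2l ?invr_ge0 ?ler0n //.
  have E a : a \in X -> d a * (\sum_(b in X) h a b) = \sum_(y in nbr_in a) \sum_(b in X) g y b.
    move=> aX; rewrite -mulr_sumr mulrA divff ?mul1r; last by rewrite gt_eqF // d_gt0.
    by rewrite exchange_big.
  rewrite (eq_bigr _ E) sum_nbr_swap.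
  by apply: ler_sum => y yX; rewrite sum_nbr_const.
(* Here [j] is the new vertex, whose image is uniform among at least [D] vertices. *)
- rewrite -(expect_marginal (n := n) (i := i) (fun a => \sum_(b in X) g a b)) //.
  rewrite mulrC.
  have -> : expect n (fun s => \sum_(b in X) g (s i) b) * D%:R^-1 =
    expect n (fun s => D%:R^-1 * \sum_(b in X) g (s i) b).
    rewrite (expect_marginal (fun x => D%:R^-1 * \sum_(b in X) g x b)) //.
    rewrite (expect_marginal (fun x => \sum_(b in X) g x b)) // mulr_suml.
    by apply: eq_bigr => x _; rewrite mulrAC -mulrA.
  rewrite /=; apply: expect_le => s ws; set w := s (p n.+1).
  have wX : w \in X by apply: walk_sub ws _; apply: le_parent.
  have -> : \sum_(y in nbr_in w) g (assign s n.+1 y i) (assign s n.+1 y n.+1) =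
    \sum_(y in nbr_in w) g (s i) y.
    by apply: eq_bigr => y _; rewrite /assign eqxx nle.
  apply: ler_pM; rewrite ?invr_ge0 ?sumr_ge0 //.
    by rewrite lef_pV2 ?posrE ?d_gt0 // le_D_d.
  exact: sum_nbr_le.
rewrite expect_assign; first exact: IH.
by move=> s y; rewrite /assign !nle.
Qed.


Lemma expect_lt_exists n F H :
  expect n F < expect n H -> exists2 s, walk n s & F s < H s.
Proof.
have gap (I : finType) (A : {set I}) (f g : I -> rat) :
    \sum_(x in A) f x < \sum_(x in A) g x -> exists2 x, x \in A & f x < g x.
  move=> fg; apply/exists_inP; apply: contraT => /exists_inPn h.
  by move: fg; rewrite ltNge ler_sum // => x /h; rewrite -leNgt.
elim: n F H => [|n IH] F H /=.
  case/gap=> x xX; rewrite ltr_pM2l ?d_gt0 // => FH; exists (fun=> x) => //.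
  by split=> // -[].
case/IH=> s ws; rewrite ltr_pM2l ?invr_gt0 ?d_gt0 ?(walk_sub ws) //.
by case/gap=> y yN FH; exists (assign s n.+1 y) => //; apply: walkS.
Qed.

Let total := \sum_(x in X) d x.

Lemma expect_const n (c : rat) : expect n (fun=> c) = total * c.
Proof. by rewrite (expect_marginal (i := 0) (fun=> c)) // mulr_suml. Qed.

Lemma expect_collision n i j : (i <= n)%N -> (j <= n)%N -> i != j ->
  expect n (fun s => (s i == s j)%:R) <= total / D%:R.
Proof.
move=> ni nj ij.
apply: le_trans (expect_joint (g := fun a b => (a == b)%:R) ni nj ij _) _ => //.
rewrite mulrC ler_pM2r ?invr_gt0 //; apply: ler_sum => a aX.
rewrite -[leRHS]mulr1 ler_wpM2l // (bigD1 a) //= eqxx big1 ?addr0 // => b /andP[_ ba].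
by rewrite eq_sym (negPf ba).
Qed.

Definition bad (q : nat) (v : G) : {set G} :=
  [set u in X | (#|nbr_in v| <= q * #|nbr_in v :&: nbr u|)%N].

(** Let [v] be the image of [p i]. If the image of [j] is not bad for [v], a uniform neighbour of
    [v] is adjacent to it with probability below [1 / q]; it is bad with probability at most [M / D]
    by [expect_joint], as [p i] differs from [j]. *)
Lemma expect_adjacent n i j (q M : nat) : (0 < q)%N ->
  (forall v, v \in X -> #|bad q v| <= M)%N ->
  (i <= n)%N -> (j < i)%N -> p i != j ->
  expect n (fun s => (adj (s i) (s j))%:R) <= total * (q%:R^-1 + M%:R / D%:R).
Proof.
move=> q0 badM ni ji pij; elim: n ni => [|n IH].
  by rewrite leqn0 => /eqP i0; rewrite i0 in ji.
rewrite leq_eqVlt ltnS => /predU1P[En|ni]; last first.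
  rewrite expect_assign ?IH // => s y; rewrite /assign.
  by case: eqP ni => [->|_ ni]; rewrite ?ltnn //; case: eqP => // E; lia.
rewrite {}En in ji pij *; rewrite ltnS in ji.
pose g a b : rat := (b \in bad q a)%:R.
apply: (@le_trans _ _ (expect n (fun s => q%:R^-1 + g (s (p n.+1)) (s j)))).
  rewrite /=; apply: expect_le => s ws; set v := s (p n.+1).
  have vX : v \in X by apply: walk_sub ws _; apply: le_parent.
  have -> : \sum_(y in nbr_in v) (adj (assign s n.+1 y n.+1) (assign s n.+1 y j))%:R =
      #|nbr_in v :&: nbr (s j)|%:R :> rat.
    rewrite -sum1_card natr_sum [RHS](eq_bigl (fun y => (y \in nbr_in v) && adj y (s j))).
      rewrite [RHS]big_mkcondr; apply: eq_bigr => y _; rewrite /assign eqxx.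
      by case: eqP => [E|_]; [lia | case: adj].
    by move=> y; rewrite !inE [adj y _]adj_sym.
  rewrite ler_pdivrMl ?d_gt0 // mulrDr /g inE (walk_sub ws) //=.
  case: leqP => h; last first.
    by rewrite mulr0 addr0 ler_pdivlMr ?ltr0n // -natrM ler_nat mulnC ltnW.
  rewrite mulr1 (@le_trans _ _ (d v)) ?ler_nat ?subset_leq_card ?subsetIl //.
  by rewrite lerDr mulr_ge0 ?invr_ge0 ?ler0n.
rewrite expectD expect_const mulrDr lerD2l.
apply: le_trans (expect_joint (g := g) (le_parent n) ji pij _) _; first by move=> a b; apply: ler0n.
rewrite mulrA [leRHS]mulrC ler_wpM2l ?invr_ge0 ?ler0n // mulr_suml.
apply: ler_sum => a aX; rewrite ler_wpM2l // -natr_sum ler_nat.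
apply: leq_trans (badM a aX); rewrite -sum1_card [leqRHS]big_mkcond [leqLHS]big_mkcond /=.
by apply: leq_sum => b _; case: ifP => //; case: (b \in bad q a).
Qed.

(** First moment: [cnt] counts coincidences and unwanted adjacencies. There are at most [n.+1 ^ 2]
    pairs, each contributing at most [eps] to the mean, which is therefore at most 1/2. *)
Lemma exists_induced_walk n (q M : nat) :
  X != set0 -> (forall v, v \in X -> #|bad q v| <= M)%N ->
  q = (4 * n.+1 ^ 2)%N -> (4 * n.+1 ^ 2 * M.+1 <= D)%N ->
  exists s : nat -> G, walk n s /\ forall i j, (j < i <= n)%N ->
    s i != s j /\ (p i != j -> ~~ adj (s i) (s j)).
Proof.
move=> X0 badM qE DM.
pose cnt (s : nat -> G) := (\sum_(i < n.+1) \sum_(j < n.+1 | j < i)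
  ((s i == s j) + ((p i != j) && adj (s i) (s j))))%N.
have q0 : (0 < q)%N by rewrite qE muln_gt0 expn_gt0.
have total_gt0 : 0 < total.
  have [x xX] := set0Pn _ X0; rewrite /total (bigD1 x) //=.
  by rewrite ltr_wpDr ?d_gt0 // sumr_ge0.
(* Here [1 / q + M / D] pays for an unwanted edge and a further [1 / D] for a coincidence. *)
pose eps : rat := q%:R^-1 + M.+1%:R / D%:R.
have eps0 : 0 <= eps by rewrite addr_ge0 ?mulr_ge0 ?invr_ge0 ?ler0n.
have [|s ws cs] := @expect_lt_exists n (fun s => (cnt s)%:R) (fun=> 1).
  rewrite expect_const mulr1.
  have -> : expect n (fun s => (cnt s)%:R) = \sum_(i < n.+1) \sum_(j < n.+1 | (j < i)%N)
    (expect n (fun s => (s i == s j)%:R) + expect n (fun s => ((p i != j) && adj (s i) (s j))%:R)).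
    rewrite -(eq_expect (F := fun s => \sum_(i < n.+1) \sum_(j < n.+1 | (j < i)%N)
      ((s i == s j)%:R + ((p i != j) && adj (s i) (s j))%:R))); last first.
      move=> s _; rewrite /cnt natr_sum; apply: eq_bigr => i _; rewrite natr_sum.
      by apply: eq_bigr => j _; rewrite natrD.
    rewrite expect_sum; apply: eq_bigr => i _; rewrite expect_sum.
    by apply: eq_bigr => j _; rewrite expectD.
  apply: (@le_lt_trans _ _ (\sum_(i < n.+1) \sum_(j < n.+1) total * eps)).
    apply: ler_sum => i _; rewrite big_mkcond; apply: ler_sum => j _.
    case: ifP => [ji|_]; last by rewrite mulr_ge0 // ltW.
    have -> : total * eps = total / D%:R + total * (q%:R^-1 + M%:R / D%:R).
      by rewrite /eps -[M.+1%:R]natr1; ring.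
    apply: lerD; first by apply: expect_collision; rewrite -1?ltnS // neq_ltn ji orbT.
    have [_|pij] /= := eqVneq (p i) j.
      by rewrite expect_const mulr0 mulr_ge0 ?(ltW total_gt0) // addr_ge0 ?mulr_ge0 ?invr_ge0 ?ler0n.
    by apply: (expect_adjacent (i := i) (j := j)); rewrite // -1?ltnS.
  rewrite !sumr_const !card_ord -mulrnA -[_ *+ _]mulr_natr -mulrA -[ltRHS]mulr1 ltr_pM2l //.
  rewrite mulnn; set K := (n.+1 ^ 2)%N in qE DM *.
  have K0 : 0 < K%:R :> rat by rewrite ltr0n expn_gt0.
  have qK : q%:R^-1 * K%:R = 4%:R^-1 :> rat.
    by rewrite qE natrM invfM -mulrA mulVf ?mulr1 // gt_eqF.
  have DK : M.+1%:R / D%:R * K%:R <= 4%:R^-1 :> rat.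
    rewrite mulrAC ler_pdivrMr // ler_pdivlMl ?ltr0n // -!natrM ler_nat.
    by apply: leq_trans DM; rewrite -mulnA [(M.+1 * K)%N]mulnC.
  by rewrite /eps mulrDl qK; lra.
exists s; split=> // i j /andP[ji ni].
move: cs; rewrite -[1]/(1%:R) ltr_nat ltnS leqn0 sum_nat_eq0 => /forallP/(_ (inord i)) /=.
rewrite sum_nat_eq0 => /forall_inP/(_ (inord j)); rewrite !inordK ?ltnS //; last by lia.
move=> /(_ ji); rewrite addn_eq0 !eqb0 negb_and negbK => /andP[-> /orP[/eqP|] h]; split=> //.
by rewrite h eqxx.
Qed.

End RandomHomomorphism.

(** * Bounded degeneracy *)

Definition biclique_free (G : sgraph) (N : nat) : Prop :=
  forall A B : {set G}, complete_between A B -> N <= #|A| -> N <= #|B| -> False.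

Lemma exists_subset_card (T : finType) (A : {set T}) (m : nat) :
  m <= #|A| -> exists2 U : {set T}, U \subset A & #|U| = m.
Proof.
move=> mA; exists [set x in take m (enum A)].
  by apply/subsetP=> x; rewrite inE => /mem_take; rewrite mem_enum.
by rewrite cardsE (card_uniqP _) ?take_uniq ?enum_uniq // size_takel // -cardE.
Qed.

Lemma card_sum_mem (T : finType) (A : {set T}) (P : pred T) :
  #|[set x in A | P x]| = \sum_(x in A) P x.
Proof.
by rewrite -sum1dep_card big_mkcondr; apply: eq_bigr => x _; case: (P x).
Qed.

Lemma sum_card_swap (T : finType) (A B : {set T}) (e : rel T) : symmetric e ->
  \sum_(x in A) #|[set y in B | e x y]| = \sum_(y in B) #|[set x in A | e y x]|.
Proof.
move=> esym; rewrite (eq_bigr _ (fun x _ => card_sum_mem B (e x))).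
rewrite [RHS](eq_bigr _ (fun y _ => card_sum_mem A (e y))).
by rewrite exchange_big; apply: eq_bigr => y _; apply: eq_bigr => x _; rewrite esym.
Qed.

(* Otherwise some [q * N] bad vertices [U] receive [N #|nbr_in X v|] edges from the
   neighbourhood of [v], yet all but boundedly many neighbours of [v] have a trace on [U]
   that is shared by [N] of them, hence has fewer than [N] elements. *)
Lemma card_bad (G : sgraph) (X : {set G}) (q N : nat) (v : G) :
  biclique_free G N -> 0 < q ->
  2 ^ (q * N) * N * (q * N) < #|nbr_in X v| -> #|bad X q v| <= q * N.
Proof.
move=> bf q0; set M := q * N; set B := nbr_in X v => big; rewrite leqNgt; apply/negP=> badM.
have [U Ubad UM] := exists_subset_card (ltnW badM).
pose tr y := [set u in U | adj y u].
pose fiber W := [set y in B | tr y == W].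
pose few := [set W in powerset U | #|fiber W| < N].
pose rare := \bigcup_(W in few) fiber W.
have rareM : #|rare| <= 2 ^ M * N.
  apply: leq_trans (card_bigcup_leq few fiber) _.
  rewrite (@leq_trans (\sum_(W in few) N)) //.
    by apply: leq_sum => W; rewrite inE => /andP[_ /ltnW].
  rewrite sum_nat_const leq_mul2r -UM -card_powerset subset_leq_card ?orbT //.
  by apply/subsetP=> W; rewrite inE => /andP[].
have common y : y \in B -> y \notin rare -> #|tr y| < N.
  move=> yB yr; rewrite ltnNge; apply/negP=> trN.
  have [fN|] := leqP N #|fiber (tr y)|.
    apply: (bf _ _ _ trN fN) => u z; rewrite !inE => /andP[uU yu] /andP[zB /eqP tzy].
    have : u \in tr z by rewrite tzy inE uU.
    by rewrite inE adj_sym => /andP[].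
  move=> fN; move/negP: yr; apply; apply/bigcupP; exists (tr y); last by rewrite inE yB eqxx.
  by rewrite inE fN andbT powersetE; apply/subsetP=> u; rewrite inE => /andP[].
have lower : N * #|B| <= \sum_(y in B) #|tr y|.
  rewrite /tr (sum_card_swap _ _ (@adj_sym G)) -(leq_pmul2l q0) mulnA -/M -UM -sum_nat_const big_distrr /=.
  apply: leq_sum => u /(subsetP Ubad); rewrite inE => /andP[_]; congr (_ <= q * _).
  by apply: eq_card => y; rewrite !inE.
have upper : \sum_(y in B) #|tr y| <= #|rare| * M + #|B| * N.-1.
  rewrite -!sum_nat_const [X in _ <= X + _]big_mkcond [X in _ <= _ + X]big_mkcond [leqLHS]big_mkcond.
  rewrite -big_split; apply: leq_sum => y _; case: ifP => // yB.
  case: ifPn => [_|yr]; last by have /= := common y yB yr; lia.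
  rewrite (@leq_trans M) ?leq_addr // -UM; apply: subset_leq_card.
  by apply/subsetP=> u; rewrite inE => /andP[].
have N0 : 0 < N.
  rewrite lt0n; apply/eqP=> N0; apply: (bf set0 set0); rewrite ?N0 // => x y.
  by rewrite inE.
have rB : #|rare| * M < #|B| by apply: leq_ltn_trans big; rewrite leq_mul2r rareM orbT.
(* The two counts leave [#|B| <= #|rare| * M], which is smaller than [#|B|]. *)
have := leq_trans lower upper.
by rewrite -{1}(prednK N0) mulSn [N.-1 * _]mulnC leq_add2r leqNgt rB.
Qed.

(** An induced copy of the 1-subdivision of the tree on [0, ..., n - 1]: [x i] is a branch vertex
    and [b j] subdivides the edge above [j]. *)
Definition subdiv_copy (G : sgraph) (p : nat -> nat) (n : nat) : Prop :=
  exists x b : nat -> G,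
  [/\ forall i j, i < n -> j < n -> x i = x j -> i = j,
      forall i j, 0 < i < n -> 0 < j < n -> b i = b j -> i = j,
      forall i j, i < n -> j < n -> ~~ adj (x i) (x j),
      forall i j, 0 < i < n -> 0 < j < n -> ~~ adj (b i) (b j) &
      forall i j, i < n -> 0 < j < n -> x i <> b j /\ adj (x i) (b j) = incident p i j].

Lemma subdiv_copy_induced (G T : sgraph) (A : {set T}) p n f :
  (forall x y : T, adj x y -> (x \in A) != (y \in A)) ->
  subdiv_embedding A [set: T] p n f -> subdiv_copy G p n -> is_induced_subgraph T G.
Proof.
move=> bipA [fn f0 finj fE] [x [b [xinj binj xx bb xb]]].
have {}fn v : f v < n by apply: fn.
have {f0} fB v : v \notin A -> 0 < f v < n by move=> vA; rewrite fn andbT f0.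
have {}finj v w : (v \in A) = (w \in A) -> f v = f w -> v = w by apply: finj.
have {}fE v w : v \in A -> w \notin A -> adj v w = incident p (f v) (f w) by apply: fE.
exists (fun v => if v \in A then x (f v) else b (f v)); split=> v w.
  case: ifP => [vA|/negbT vA]; case: ifP => [wA|/negbT wA] E.
  - by apply: finj; [rewrite vA wA | apply: xinj E].
  - by have [] := xb _ _ (fn v) (fB w wA).
  - by have [h _] := xb _ _ (fn w) (fB v vA); case: h.
  - by apply: finj; [rewrite (negPf vA) (negPf wA) | apply: binj E; apply: fB].
case: ifP => [vA|/negbT vA]; case: ifP => [wA|/negbT wA].
- rewrite (negPf (xx _ _ (fn v) (fn w))); apply/esym; apply: contraTF (vA) => /bipA.
  by rewrite wA; case: (v \in A).
- by rewrite fE //; have [] := xb _ _ (fn v) (fB w wA).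
- by rewrite adj_sym [RHS]adj_sym fE //; have [] := xb _ _ (fn w) (fB v vA).
- rewrite (negPf (bb _ _ (fB v vA) (fB w wA))); apply/esym; apply: contraNF (vA) => /bipA.
  by rewrite (negPf wA); case: (v \in A).
Qed.

(* Numbers the 1-subdivision of the tree with parent function [p]: the branch vertex [i] is
   [2 i] and the subdivision vertex above it is [2 i - 1]. *)
Definition subdiv_parent (p : nat -> nat) (k : nat) : nat :=
  if odd k then (p k.+1./2).*2 else k.-1.

Lemma subdiv_parentP p : parent_fun p -> parent_fun (subdiv_parent p).
Proof.
move=> pp k k0; rewrite /subdiv_parent; case: ifP => kodd; last by rewrite prednK.
have := pp k.+1./2; have := odd_double_half k; rewrite kodd; lia.
Qed.

(** [q] suits a walk indexed by [0, ..., 2 n]. The first summand exceeds the threshold of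
    [card_bad]; the second is the degree that [exists_induced_walk] asks for with [M = q * N]. *)
Definition degeneracy_bound (n N : nat) : nat :=
  let q := 4 * n.*2.+1 ^ 2 in (2 ^ (q * N) * N * (q * N)).+1 + q * (q * N).+1.

Lemma subdiv_copy_free_degenerate (G : sgraph) p n N :
  parent_fun p -> biclique_free G N -> ~ subdiv_copy G p n ->
  degenerate (@adj G) (degeneracy_bound n N).
Proof.
move=> pp bf nocopy; apply: contraT => /degeneratePn[X X0 degX]; case: nocopy.
set q := 4 * n.*2.+1 ^ 2 in degX *.
have q0 : 0 < q by rewrite muln_gt0 expn_gt0.
have D0 : 0 < degeneracy_bound n N by rewrite /degeneracy_bound addSn.
have [v vX|//||s [[sX se] sind]] := @exists_induced_walk G X (subdiv_parent p) _
  (subdiv_parentP pp) D0 degX n.*2 q (q * N) X0.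
- by apply: card_bad => //; apply: leq_trans (degX v vX); apply: leq_addr.
- by rewrite /degeneracy_bound -/q leq_addl.
have sinj i j : i <= n.*2 -> j <= n.*2 -> s i = s j -> i = j.
  move=> ni nj E; case: (ltngtP i j) => // ij.
    by have [|] := sind j i; rewrite ?ij //; rewrite E eqxx.
  by have [|] := sind i j; rewrite ?ij //; rewrite E eqxx.
pose par i j := (0 < i) && (subdiv_parent p i == j).
have sadj i j : i <= n.*2 -> j <= n.*2 -> adj (s i) (s j) = par i j || par j i.
  move=> ni nj; apply/idP/idP; last first.
    case/orP=> /andP[k0 /eqP<-]; last by apply: se; rewrite k0.
    by rewrite adj_sym; apply: se; rewrite k0.
  rewrite /par; case: (ltngtP i j) => [ij|ij|->]; last by rewrite adj_irrefl.
    have [|_ h] := sind j i; first by rewrite ij.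
    rewrite adj_sym (leq_ltn_trans _ ij) //=; case: eqP h => [_ _ _|_ /(_ isT)/negPf->//].
    by rewrite orbT.
  have [|_ h] := sind i j; first by rewrite ij.
  by rewrite (leq_ltn_trans _ ij) //=; case: eqP h => [//|_ /(_ isT)/negPf->].
exists (fun i => s i.*2), (fun i => s i.*2.-1).
have parE i k : par i.*2 k = (0 < i) && (i.*2.-1 == k).
  by rewrite /par /subdiv_parent odd_double double_gt0.
have parO i k : 0 < i -> par i.*2.-1 k = ((p i).*2 == k).
  case: i => // i _; rewrite /par /subdiv_parent doubleS /= odd_double /=.
  by rewrite doubleK.
split=> [i j ni nj|i j ni nj|i j ni nj|i j ni nj|i j ni nj].
- by move/sinj => E; apply: double_inj; apply: E; lia.
- by move/sinj => E; have := E ltac:(lia) ltac:(lia); lia.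
- by rewrite sadj ?parE; lia.
- by rewrite sadj ?parO; lia.
split; first by move/sinj => E; have := E ltac:(lia) ltac:(lia); lia.
rewrite sadj ?parE ?parO /incident; lia.
Qed.

(** Averaging over all [R]: each [j] constrains at most [m] vertices, so at least a fraction
    [2 ^ -m] of all sets [R] is good for it. *)
Lemma random_subset (V J : finType) (E : {set J}) (P Q : J -> {set V}) (m : nat) :
  {in E, forall j, [disjoint P j & Q j] /\ #|P j| + #|Q j| <= m} ->
  exists R : {set V},
    #|E| <= 2 ^ m * #|[set j in E | (P j \subset R) && [disjoint Q j & R]]|.
Proof.
move=> PQ; pose good j (R : {set V}) := (P j \subset R) && [disjoint Q j & R].
have many j : j \in E -> 2 ^ #|V| <= 2 ^ m * #|[set R | good j R]|.
  (* [h] records [R] on [P j :|: Q j] and then forces the conditions there, so it is injective into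
     pairs of a trace and a good set. *)
  move=> /PQ[disj PQm]; pose h (R : {set V}) := (R :&: (P j :|: Q j), (R :\: Q j) :|: P j).
  have hinj : injective h.
    move=> R R' [/setP E1 /setP E2]; apply/setP=> x; have := E1 x; have := E2 x; rewrite !inE.
    by case: (x \in P j) => /=; case: (x \in Q j) => /=; rewrite ?andbT ?andbF ?orbF.
  rewrite -cardsT -card_powerset -(card_imset _ hinj).
  apply: (@leq_trans #|setX (powerset (P j :|: Q j)) [set R | good j R]|); last first.
    rewrite cardsX card_powerset leq_mul2r leq_exp2l // (leq_trans _ PQm) ?orbT //.
    exact: leq_card_setU.
  apply: subset_leq_card; apply/subsetP=> _ /imsetP[R _ ->].
  rewrite !inE /h /= subsetIr /= /good subsetUr /= disjoint_sym.
  apply/pred0P=> x /=; rewrite !inE; have := disjointFr disj (x := x).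
  by case: (x \in P j) => [/(_ isT)->|_]; [rewrite andbF | case: (x \in Q j); rewrite ?andbF].
have [/existsP//|] := boolP [exists R : {set V}, #|E| <= 2 ^ m * #|[set j in E | good j R]|].
move/existsPn=> none; exfalso.
have : \sum_(R : {set V}) 2 ^ m * #|[set j in E | good j R]| < \sum_(R : {set V}) #|E|.
  apply: (@leq_ltn_trans (\sum_(R : {set V}) #|E|.-1)).
    by apply: leq_sum => R _; have := none R; rewrite -ltnNge; case: #|E|.
  have := none set0; rewrite -ltnNge => /(leq_ltn_trans (leq0n _)) E0.
  rewrite !sum_nat_const ltn_pmul2l; first by rewrite prednK.
  by apply/card_gt0P; exists set0.
rewrite ltnNge => /negP; apply.
rewrite sum_nat_const -[#|{set V}|]cardsT -[setT]powersetT card_powerset cardsT mulnC.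
rewrite -big_distrr /= -sum_nat_const.
have -> : \sum_(R : {set V}) #|[set j in E | good j R]| = \sum_(j in E) #|[set R | good j R]|.
  rewrite (eq_bigr (fun R => \sum_(j in E) good j R)) => [|R _]; last exact: card_sum_mem.
  rewrite exchange_big; apply: eq_bigr => j _; rewrite -sum1dep_card [RHS]big_mkcond.
  by apply: eq_bigr => R _; case: (good j R).
by rewrite big_distrr; apply: leq_sum => j /many.
Qed.

(** Vertices are placed in the order of their indices: the image of [p m] has [n] neighbours in [Y],
    of which at most [m < n] are taken. *)
Lemma greedy_tree (V : finType) (e : rel V) (Y : {set V}) (p : nat -> nat) (n : nat) :
  parent_fun p -> Y != set0 -> (forall y, y \in Y -> n <= #|[set z in Y | e y z]|) ->
  exists x : nat -> V,
    [/\ forall i, i < n -> x i \in Y, forall i j, i < n -> j < n -> x i = x j -> i = j &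
        forall i, 0 < i < n -> e (x (p i)) (x i)].
Proof.
move=> pp /set0Pn[y0 y0Y] degY.
suff /(_ n (leqnn n)) : forall m, m <= n -> exists x : nat -> V,
    [/\ forall i, i < m -> x i \in Y, forall i j, i < m -> j < m -> x i = x j -> i = j &
        forall i, 0 < i < m -> e (x (p i)) (x i)] by [].
elim=> [_|m IH mn]; first by exists (fun=> y0); split=> // i /andP[].
have [x [xY xinj xe]] := IH (ltnW mn).
have [z [zY zx ze]] : exists z, [/\ z \in Y, forall i, i < m -> z <> x i & 0 < m -> e (x (p m)) z].
  have [m0|m0] := posnP m; first by exists y0; split; rewrite ?m0.
  pose U := [set x (i : 'I_m) | i in 'I_m]; pose W := [set z in Y | e (x (p m)) z].
  have /subsetPn[z] : ~~ (W \subset U).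
    apply/negP=> /subset_leq_card; have := degY _ (xY _ (pp _ m0)); rewrite -/W => nW WU.
    have : #|U| <= m by rewrite -[leqRHS]card_ord leq_imset_card.
    by move: nW WU mn; lia.
  rewrite inE => /andP[zY ze] zU; exists z; split=> // i im zi; case/negP: zU.
  by apply/imsetP; exists (Ordinal im).
exists (fun i => if i == m then z else x i); split=> [i|i j|i].
- by rewrite ltnS leq_eqVlt; case: eqP => //= _; apply: xY.
- rewrite ltnS leq_eqVlt [j < _]ltnS [j <= _]leq_eqVlt.
  case: eqP => [->|_] /= im; case: eqP => [->|_] //= jm E.
  + by case: (zx j jm).
  + by case: (zx i im).
  + exact: xinj.
- case/andP=> i0; rewrite ltnS leq_eqVlt => /predU1P[im|im].
    rewrite -im eqxx; have := pp _ i0; case: eqP => [->|_ _]; first by rewrite ltnn.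
    by rewrite im; apply: ze; rewrite -im.
  have pim := ltn_trans (pp _ i0) im.
  by rewrite !ltn_eqF //; apply: xe; rewrite i0.
Qed.

(** * Common in-neighbours *)

Section Augmentation.

Variables (G : sgraph) (rho : G -> nat) (d : nat).
Hypothesis rho_inj : injective rho.

(** The out-neighbours of [x] when edges point towards smaller [rho]. *)
Definition below (x : G) : {set G} := [set y | adj x y & rho y < rho x].

Hypothesis below_d : forall x, #|below x| <= d.

Definition below2 (x : G) : {set G} := below x :|: \bigcup_(z in below x) below z.

Definition cherry (x y : G) : bool :=
  [&& x != y, ~~ adj x y & [exists b, (x \in below b) && (y \in below b)]].

Definition augmented (x y : G) : bool :=
  [|| y \in below2 x, x \in below2 y | cherry x y].

Lemma cherry_sym : symmetric cherry.
Proof.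
move=> x y; rewrite /cherry eq_sym adj_sym; congr [&& _, _ & _].
by apply: eq_existsb => b; rewrite andbC.
Qed.

Lemma belowP x y : y \in below x -> adj x y /\ rho y < rho x.
Proof. by rewrite inE => /andP[]. Qed.

Lemma adj_below x y : adj x y -> (y \in below x) || (x \in below y).
Proof.
move=> xy; rewrite !inE [adj y x]adj_sym xy /=; case: ltngtP => // /rho_inj E.
by rewrite E adj_irrefl in xy.
Qed.

Lemma below2P x y : y \in below2 x -> rho y < rho x.
Proof.
case/setUP=> [/belowP[]//|/bigcupP[z /belowP[_ zx] /belowP[_ yz]]].
exact: ltn_trans yz zx.
Qed.

Lemma below2_trans x y z : y \in below x -> z \in below y -> z \in below2 x.
Proof. by move=> yx zy; apply/setUP; right; apply/bigcupP; exists y. Qed.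

Lemma card_below2 x : #|below2 x| <= d + d * d.
Proof.
rewrite (leq_trans (leq_card_setU _ _)) // leq_add //.
apply: leq_trans (card_bigcup_leq _ _) _.
rewrite (@leq_trans (\sum_(z in below x) d)) //; first exact: leq_sum.
by rewrite sum_nat_const leq_mul2r below_d orbT.
Qed.

Lemma augmented_sym : symmetric augmented.
Proof. by move=> x y; rewrite /augmented cherry_sym orbCA. Qed.

Lemma augmented_irrefl : irreflexive augmented.
Proof.
move=> x; rewrite /augmented /cherry eqxx /= orbF orbb; apply/negP=> /below2P.
by rewrite ltnn.
Qed.

Lemma adj_augmented x y : adj x y -> augmented x y.
Proof.
by move/adj_below; rewrite /augmented /below2 !in_setU => /orP[]->; rewrite ?orbT.
Qed.

(** If the edge [a b] points to [b], then [a, b, x] is a directed path; otherwise [a] and [x] are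
    both out-neighbours of [b]. *)
Lemma path_augmented a b x : adj a b -> x \in below b -> a != x -> augmented a x.
Proof.
move=> /adj_below/orP[ba|ab] bx ax; first by rewrite /augmented (below2_trans ba bx).
have [/adj_augmented//|nax] := boolP (adj a x).
rewrite /augmented /cherry ax nax /=; apply/or3P/Or33.
by apply/existsP; exists b; rewrite ab.
Qed.

(** On a path [a b x y] the middle edge points to [x] or to [b], which separates the colours of
    [a, x] or of [b, y] respectively. *)
Lemma augmented_star_colorable k : degenerate augmented k -> star_colorable G k.+1.
Proof.
case/(degenerate_coloring augmented_sym augmented_irrefl) => c hc.
apply: (star_coloringI (c := c)) => [x y /adj_augmented/hc//|a b x y ab bx xy ax by' cax cby].
have /orP[xb|xb] := adj_below bx.
  by have := hc _ _ (path_augmented ab xb ax); rewrite cax eqxx.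
have yx : adj y x by rewrite adj_sym.
have yb : y != b by rewrite eq_sym.
by have := hc _ _ (path_augmented yx xb yb); rewrite cby eqxx.
Qed.

(** Within [R], [x] and [y] are sinks and the witness [b] points to nothing else, so that copies
    assembled from such pairs are induced. *)
Definition clean_cherry (R : {set G}) (x y : G) : bool :=
  [&& x != y, x \in R, y \in R, below x :&: R == set0, below y :&: R == set0 &
      [exists b in R, below b :&: R == [set x; y]]].

Lemma clean_cherry_sym R : symmetric (clean_cherry R).
Proof.
suff h x y : clean_cherry R x y -> clean_cherry R y x by move=> x y; apply/idP/idP; apply: h.
case/and5P=> xy xR yR x0 /andP[y0 b].
by rewrite /clean_cherry eq_sym xy xR yR x0 y0 setUC.
Qed.

Lemma clean_cherry_irrefl R : irreflexive (clean_cherry R).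
Proof. by move=> x; rewrite /clean_cherry eqxx. Qed.

(* Keep the pairs both of whose ends and whose witness lie in a random set [R] that avoids
   all their other out-neighbours. *)
Lemma exists_clean_cherries (X : {set G}) : exists R : {set G},
  \sum_(x in X) #|[set y in X | cherry x y]| <=
  2 ^ (3 + 3 * d) * \sum_(x in X) #|[set y in X | clean_cherry R x y]|.
Proof.
pose wit (e : G * G) := odflt e.1 [pick b | (e.1 \in below b) && (e.2 \in below b)].
pose E := [set e : G * G | [&& e.1 \in X, e.2 \in X & cherry e.1 e.2]].
pose P (e : G * G) := [set e.1; e.2; wit e].
pose Q (e : G * G) := (below e.1 :|: below e.2 :|: below (wit e)) :\: P e.
have card_pairs (r : rel G) :
    \sum_(x in X) #|[set y in X | r x y]| = #|[set e : G * G | [&& e.1 \in X, e.2 \in X & r e.1 e.2]]|.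
  rewrite (eq_bigr _ (fun x _ => card_sum_mem X (r x))) pair_big_dep /= -sum1dep_card.
  rewrite [LHS]big_mkcond [RHS]big_mkcond; apply: eq_bigr => -[x y] _ /=.
  by case: (x \in X); case: (y \in X); case: (r x y).
have [e|R ER] := @random_subset _ _ E P Q (3 + 3 * d).
  move=> _; split.
    by rewrite disjoint_sym disjoints_subset; apply/subsetP=> z; rewrite !inE => /andP[].
  apply: leq_add.
    rewrite /P (leq_trans (leq_card_setU _ _)) // cards1 addn1 ltnS cards2; by case: eqP.
  apply: leq_trans (subset_leq_card (subsetDl _ _)) _.
  rewrite (leq_trans (leq_card_setU _ _)) // mulSn mulSn mul1n addnA leq_add //.
  by rewrite (leq_trans (leq_card_setU _ _)) // leq_add.
exists R; rewrite !card_pairs; apply: leq_trans ER _; rewrite leq_mul2l subset_leq_card ?orbT //.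
apply/subsetP=> -[x y]; rewrite !inE /= => /andP[/and3P[-> -> /and3P[xy nxy exb]] /andP[PR QR]] /=.
have [xb yb] : x \in below (wit (x, y)) /\ y \in below (wit (x, y)).
  rewrite /wit /=; case: pickP => [b /andP[]//|no]; case/existsP: exb => b.
  by have /= -> := no b.
set b := wit (x, y) in xb yb.
have [xR yR bR] : [/\ x \in R, y \in R & b \in R].
  by split; apply: (subsetP PR); rewrite !inE /= eqxx ?orbT.
have inP z : z \in R -> z \in below x :|: below y :|: below b -> z \in [set x; y; b].
  move=> zR zb; apply: contraTT zR => zP; rewrite (disjointFr QR) //.
  by rewrite /Q /= inE zb andbT.
(* An out-neighbour in [R] could only be [x], [y] or [b]: the former are nonadjacent, and [b] has
   larger [rho]. *)
have below0 u : u \in [set x; y] -> below u :&: R == set0.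
  move=> uxy; apply/set0Pn=> -[z /setIP[zu zR]].
  have [adjuz ltzu] := belowP zu.
  have ltub : rho u < rho b by case/set2P: uxy => ->; [case: (belowP xb) | case: (belowP yb)].
  have : z \in [set x; y; b].
    by apply: inP zR _; case/set2P: uxy zu => ->; rewrite !in_setU => ->; rewrite ?orbT.
  rewrite in_setU => /orP[zxy|/set1P zb]; last by move: (ltn_trans ltzu ltub); rewrite zb ltnn.
  by case/set2P: uxy adjuz => ->; case/set2P: zxy => ->; rewrite ?adj_irrefl ?(negPf nxy) // adj_sym (negPf nxy).
rewrite /clean_cherry xy xR yR !below0 ?set21 ?set22 //=.
apply/exists_inP; exists b => //; rewrite eqEsubset; apply/andP; split; apply/subsetP=> z.
  case/setIP=> zb zR; have : z \in [set x; y; b] by apply: inP; rewrite // in_setU zb orbT.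
  by rewrite in_setU => /orP[//|/set1P zE]; have [] := belowP zb; rewrite zE adj_irrefl.
by case/set2P=> ->; apply/setIP.
Qed.

(** Branch vertices are sinks inside [R], hence independent. Witnesses point only to branch vertices
    and are not sinks, so they are independent and distinct from the branch vertices. *)
Lemma clean_cherry_copy (R : {set G}) (p : nat -> nat) (n : nat) (x : nat -> G) :
  parent_fun p -> (forall i j, i < n -> j < n -> x i = x j -> i = j) ->
  (forall i, i < n -> x i \in R /\ below (x i) :&: R = set0) ->
  (forall i, 0 < i < n -> clean_cherry R (x (p i)) (x i)) ->
  subdiv_copy G p n.
Proof.
move=> pp xinj xR xe.
pose b i := odflt (x 0) [pick b | (b \in R) && (below b :&: R == [set x (p i); x i])].
have bP i : 0 < i < n -> b i \in R /\ below (b i) :&: R = [set x (p i); x i].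
  move=> /xe/and5P[_ _ _ _ /andP[_ /exists_inP[c cR cE]]]; rewrite /b.
  by case: pickP => [z /andP[zR /eqP]//|/(_ c)]; rewrite cR cE.
have pn i : 0 < i < n -> p i < n by move=> /andP[i0 ni]; apply: ltn_trans (pp _ i0) ni.
have memb i j : i < n -> 0 < j < n -> (x i \in below (b j) :&: R) = incident p i j.
  move=> ni nj; have [_ ->] := bP j nj; rewrite /incident orbC !inE.
  have /andP[_ jn] := nj; congr (_ || _); apply/eqP/eqP=> [|->//]; apply: xinj => //.
  exact: pn.
have xb i j : i < n -> 0 < j < n -> x i <> b j.
  move=> ni nj E; have [_ b0] := xR i ni; have [_ bj] := bP j nj.
  have /andP[_ jn] := nj.
  have : x j \in below (b j) :&: R by rewrite bj set22.
  by rewrite -E b0 inE.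
exists x, b; split=> // [i j ni nj E|i j ni nj|i j ni nj|i j ni nj].
(* A common witness makes each index equal to the other or to its parent; as parents are smaller,
   the indices agree. *)
- have [/andP[i0 iN] /andP[j0 jN]] := (ni, nj).
  have := memb i j iN nj; rewrite -E memb // /incident eqxx => /esym.
  have := memb j i jN ni; rewrite E memb // /incident eqxx => /esym.
  by have := pp i i0; have := pp j j0; lia.
- apply/negP=> /adj_below/orP[h|h].
    by have [_] := xR i ni; have [xj _] := xR j nj; move/setP/(_ (x j)); rewrite !in_setI h xj inE.
  by have [_] := xR j nj; have [xi _] := xR i ni; move/setP/(_ (x i)); rewrite !in_setI h xi inE.
- have noadj k l : 0 < k < n -> 0 < l < n -> b k \in below (b l) -> False.
    move=> nk nl h; have [bk _] := bP k nk; have [_ bl] := bP l nl.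
    have : b k \in below (b l) :&: R by rewrite inE h bk.
    have /andP[_ ln] := nl.
    by rewrite bl => /set2P[]/esym; apply: xb => //; apply: pn.
  by apply/negP=> /adj_below/orP[]; apply: noadj.
split; first exact: xb.
have [xiR x0] := xR i ni; have [bjR _] := bP j nj.
rewrite -memb // inE xiR andbT; apply/idP/idP=> [/adj_below/orP[h|//]|/belowP[]]; last by rewrite adj_sym.
by move/setP/(_ (b j)): x0; rewrite !in_setI h bjR inE.
Qed.

(** If all degrees in [X] are large, [below2] accounts for at most [2 * (d + d * d) * #|X|] ordered
    pairs, so there are many cherries. Their clean part then violates [degenerate_card_pairs], and
    [greedy_tree] finds the tree in it. *)
Lemma subdiv_copy_free_augmented (p : nat -> nat) (n : nat) :
  parent_fun p -> ~ subdiv_copy G p n ->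
  degenerate augmented (2 * (d + d * d) + 2 ^ (3 + 3 * d) * (2 * n)).+1.
Proof.
move=> pp nocopy; apply: contraT => /degeneratePn[X X0 degX]; case: nocopy.
have [R hR] := exists_clean_cherries X.
have [deg|/degeneratePn[Y Y0 degY]] := boolP (degenerate (clean_cherry R) n); last first.
  have [x [xY xinj xe]] := greedy_tree pp Y0 degY.
  apply: (clean_cherry_copy pp xinj _ xe) => i ni.
  have n0 : 0 < n by apply: leq_ltn_trans ni.
  have [z] : exists z, z \in [set z in Y | clean_cherry R (x i) z].
    by apply/card_gt0P; apply: leq_trans (degY _ (xY i ni)).
  by rewrite inE => /andP[_ /and5P[_ ? _ /eqP ? _]].
exfalso.
have := degenerate_card_pairs X (@clean_cherry_sym R) (@clean_cherry_irrefl R) deg.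
rewrite -(leq_pmul2l (expn_gt0 2 (3 + 3 * d))) => /(leq_trans hR) cherries.
have belows : \sum_(x in X) #|[set y in X | y \in below2 x]| <= (d + d * d) * #|X|.
  rewrite mulnC -sum_nat_const; apply: leq_sum => x _; apply: leq_trans (card_below2 x).
  by apply: subset_leq_card; apply/subsetP=> y; rewrite inE => /andP[].
have aboves : \sum_(x in X) #|[set y in X | x \in below2 y]| <= (d + d * d) * #|X|.
  apply: leq_trans belows.
  rewrite (eq_bigr _ (fun x _ => card_sum_mem X (fun y => x \in below2 y))).
  by rewrite exchange_big leq_eqVlt; apply/orP; left; apply/eqP/eq_bigr => y _; rewrite card_sum_mem.
have : (2 * (d + d * d) + 2 ^ (3 + 3 * d) * (2 * n)).+1 * #|X| <=
    \sum_(x in X) #|[set y in X | y \in below2 x]| +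
    (\sum_(x in X) #|[set y in X | x \in below2 y]| + \sum_(x in X) #|[set y in X | cherry x y]|).
  rewrite -!big_split mulnC -sum_nat_const; apply: leq_sum => x xX; apply: leq_trans (degX x xX) _.
  rewrite !card_sum_mem -!big_split; apply: leq_sum => y _; rewrite /augmented.
  by case: (y \in _); case: (x \in _); case: cherry.
have : 0 < #|X| by rewrite card_gt0.
move: cherries belows aboves; set S1 := \sum_(x in X) _; set S2 := \sum_(x in X) _; set S3 := \sum_(x in X) _.
rewrite !mulnA mulSn mulnDl -!mulnA; lia.
Qed.

End Augmentation.

(** * Combining the bounds into the characterisation *)

Definition copy_free_bound (n N : nat) : nat :=
  let d := degeneracy_bound n N in (2 * (d + d * d) + 2 ^ (3 + 3 * d) * (2 * n)).+2.

Lemma subdiv_copy_free_chi_s (G : sgraph) p n N :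
  parent_fun p -> biclique_free G N -> ~ subdiv_copy G p n -> chi_s G <= copy_free_bound n N.
Proof.
move=> pp bf nocopy.
have [rho rho_inj hrho] := degenerate_rank (subdiv_copy_free_degenerate pp bf nocopy).
have below_d x : #|below rho x| <= degeneracy_bound n N by apply/ltnW/hrho.
apply/chi_s_leq/(augmented_star_colorable rho_inj).
exact: (subdiv_copy_free_augmented rho_inj below_d pp nocopy).
Qed.

Theorem theorem1 (T : sgraph) (r t : nat) :
  forest T -> 0 < r -> r <= t ->
  (chi_s_bounded (free2 T (Kbip r t)) <->
   (r = 1 \/ exists S : sgraph, tree S /\ is_subgraph T (subdivision S))).
Proof.
move=> fT r0 rt; split.
  case=> f fP; have [->|r1] := eqVneq r 1; [by left | right].
  have {r0} r1 : 1 < r by rewrite ltn_neqAle eq_sym r1.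
  (* Subdivisions have clique number at most 2, so [k] bounds [f] there, while [k * k + 1] branch
     vertices force more than [k] colours. *)
  pose k := maxn (f 0) (maxn (f 1) (f 2)); pose H := subdivision (complete (k * k).+1).
  have fk : f (omega H) <= k.
    by move: (omega_subdivision (complete (k * k).+1)); rewrite -/H /k; case: (omega H) => [|[|[|]]] //; lia.
  have TH : is_subgraph T H.
    have [[g [injg gE]]|noT] := Classical_Prop.classic (is_induced_subgraph T H).
      by exists g; split=> // x y; rewrite gE.
    have := fP H (conj noT (subdivision_Kbip_free r1 (leq_trans r1 rt))).
    rewrite leqNgt (leq_ltn_trans fk) //; exact: chi_s_subdivision_complete.
  have [A [bipA degA]] := subdivision_bipartition TH.
  have [p [[|n] [g [pp // _ emb]]]] := forest_subdiv_embedding bipA degA fT.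
  by exists (parent_tree n pp); split; [apply: parent_tree_tree | apply: subdiv_embedding_subgraph bipA emb].
have [r1|r1] := eqVneq r 1.
  move=> _; subst r; pose D k := 2 ^ (k.+1 + t); exists (fun k => (D k + D k * D k).+2) => G [_ fG].
  by apply: chi_s_max_degree => x; apply/ltnW/K1t_free_degree.
case=> [/eqP|[S [_ TS]]]; first by rewrite (negPf r1).
(* The given embedding may fail to be induced; it supplies the bipartition, from which [T] is
   embedded afresh with exact incidences. *)
have [A [bipA degA]] := subdivision_bipartition TS.
have [p [n [g [pp _ emb]]]] := forest_subdiv_embedding bipA degA fT.
exists (fun k => copy_free_bound n (2 ^ (k.+1 + t))) => G [noT noK].
apply: (subdiv_copy_free_chi_s pp) => [B C BC|copy]; first exact: (Kbip_free_biclique noK rt BC).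
by apply: noT; apply: subdiv_copy_induced bipA emb copy.
Qed.
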